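(* Let $N$ be an infinitely generated free nilpotent group of nilpotency class two. Then the outer automorphism group $\mathrm{Out}(N)=\mathrm{Aut}(N)/\mathrm{Inn}(N)$ is complete.
   Context: A group $G$ is called complete if its center is trivial and every automorphism of $G$ is inner. A free nilpotent group of class two is a relatively free group $F/\gamma_3(F)$, where $F$ is a free group and $\gamma_3(F)=[[F,F],F]$; its rank is the rank of $F$. ''Infinitely generated'' means of arbitrary infinite rank (not necessarily countable). *)

(* Defs.v *)
From HB Require Import structures.
From mathcomp Require Import all_boot generic_quotient.
From mathcomp Require Import boolp classical_sets functions cardinality.

Set Implicit Arguments.
Unset Strict Implicit.
Unset Printing Implicit Defensive.

Local Open Scope classical_set_scope.
Local Open Scope quotient_scope.
Local Open Scope group_scope.

Definition is_subgroup (G : groupType) (K : set G) : Prop :=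
  [/\ K 1, forall x y, K x -> K y -> K (x * y) & forall x, K x -> K x^-1].

Record normalSubgroup (G : groupType) := NormalSubgroup {
  nsg_set :> G -> Prop;
  nsg_subgroup : is_subgroup nsg_set;
  nsg_conjg : forall x y, nsg_set x -> nsg_set (x ^ y)
}.

Section Quotient.
Variables (G : groupType) (K : normalSubgroup G).

Lemma nsg1 : K 1. Proof. by case: (nsg_subgroup K). Qed.
Lemma nsgM x y : K x -> K y -> K (x * y).
Proof. by case: (nsg_subgroup K) => _ + _; apply. Qed.
Lemma nsgV x : K x -> K x^-1.
Proof. by case: (nsg_subgroup K) => _ _; apply. Qed.

Definition coset_rel (x y : G) : bool := `[< K (x^-1 * y) >].

Lemma coset_rel_equiv : equiv_class_of coset_rel.
Proof.
have symm x y : coset_rel x y -> coset_rel y x.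
  by move=> /asboolP /nsgV; rewrite invgM invgK => ?; apply/asboolP.
split.
- by move=> x; apply/asboolP; rewrite mulVg; exact: nsg1.
- by move=> x y; apply/idP/idP; apply: symm.
- move=> y x z /asboolP xy /asboolP yz; apply/asboolP.
  by have := nsgM xy yz; rewrite mulgA mulgK.
Qed.

Canonical coset_rel_equivRel := EquivRelPack coset_rel_equiv.

Definition quotient_group := {eq_quot coset_rel}.

HB.instance Definition _ := Choice.on quotient_group.
HB.instance Definition _ := EqQuotient.on quotient_group.

Lemma quot_eqP (x y : G) :
  reflect (K (x^-1 * y)) (\pi_quotient_group x == \pi_quotient_group y).
Proof. by rewrite eqmodE; exact: asboolP. Qed.

Lemma quot_ind (P : quotient_group -> Prop) :
  (forall x, P (\pi_quotient_group x)) -> forall u, P u.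
Proof. by move=> Ppi u; rewrite -(reprK u). Qed.

Definition quot_one : quotient_group := \pi_quotient_group 1.
Definition quot_inv (u : quotient_group) : quotient_group :=
  \pi_quotient_group (repr u)^-1.
Definition quot_mul (u v : quotient_group) : quotient_group :=
  \pi_quotient_group (repr u * repr v).

Lemma quot_mulE x y : quot_mul (\pi_quotient_group x) (\pi_quotient_group y) =
  \pi_quotient_group (x * y).
Proof.
have xP : K (x^-1 * repr (\pi_quotient_group x)).
  by apply/quot_eqP; rewrite reprK.
have yP : K (y^-1 * repr (\pi_quotient_group y)).
  by apply/quot_eqP; rewrite reprK.
apply/esym/eqP/quot_eqP.
have := nsgM (nsg_conjg y xP) yP.
by rewrite /conjg invgM !mulgA mulgK.
Qed.

Lemma quot_invE x : quot_inv (\pi_quotient_group x) = \pi_quotient_group x^-1.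
Proof.
have xP : K (x^-1 * repr (\pi_quotient_group x)).
  by apply/quot_eqP; rewrite reprK.
apply/eqP/quot_eqP; rewrite invgK.
have := nsg_conjg x^-1 xP.
by rewrite /conjg invgK !mulgA mulgV mul1g.
Qed.

Lemma quot_mulA : associative quot_mul.
Proof.
by elim/quot_ind=> x; elim/quot_ind=> y; elim/quot_ind=> z; rewrite !quot_mulE mulgA.
Qed.
Lemma quot_mul1g : left_id quot_one quot_mul.
Proof. by elim/quot_ind=> x; rewrite quot_mulE mul1g. Qed.
Lemma quot_mulg1 : right_id quot_one quot_mul.
Proof. by elim/quot_ind=> x; rewrite quot_mulE mulg1. Qed.
Lemma quot_mulVg : left_inverse quot_one quot_inv quot_mul.
Proof. by elim/quot_ind=> x; rewrite quot_invE quot_mulE mulVg. Qed.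
Lemma quot_mulgV : right_inverse quot_one quot_inv quot_mul.
Proof. by elim/quot_ind=> x; rewrite quot_invE quot_mulE mulgV. Qed.

HB.instance Definition _ := isGroup.Build quotient_group
  quot_mulA quot_mul1g quot_mulg1 quot_mulVg quot_mulgV.

End Quotient.

Definition isomorphic (G H : groupType) : Prop :=
  exists f : {multiplicative G -> H}, bijective f.

(* [A, B] is the subgroup generated by the commutators, not just their set. *)
Definition commutator (G : groupType) (A B : set G) : set G :=
  smallest (@is_subgroup G) [set [~ x, y] | x in A & y in B].

Definition gamma3_set (G : groupType) : set G :=
  commutator (commutator [set: G] [set: G]) [set: G].

Section Gamma3.
Variable G : groupType.

Lemma commutator_subgroup (A B : set G) : is_subgroup (commutator A B).
Proof.
split; first by move=> K [[]].
  move=> x y Kx Ky K KP; have [[_ KM _] _] := KP.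
  by apply: KM; [exact: Kx | exact: Ky].
by move=> x Kx K KP; have [[_ _ KV] _] := KP; apply: KV; exact: Kx.
Qed.

Lemma commutator_conjg (A B : set G) :
  (forall x y, A x -> A (x ^ y)) -> (forall x y, B x -> B (x ^ y)) ->
  forall x y, commutator A B x -> commutator A B (x ^ y).
Proof.
move=> AJ BJ x y; have [C1 CM CV] := commutator_subgroup A B.
move=> /(_ [set z | commutator A B (z ^ y)]); apply; split.
  split=> /=; first by rewrite conj1g.
    by move=> u v; rewrite conjMg; exact: CM.
  by move=> u; rewrite conjVg; exact: CV.
move=> _ [a Aa [b Bb <-]] /=; rewrite conjRg => K [_]; apply.
by exists (a ^ y); [exact: AJ | exists (b ^ y); [exact: BJ |]].
Qed.

Lemma gamma3_conjg x y : gamma3_set x -> gamma3_set (x ^ y :> G).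
Proof. by apply: commutator_conjg => //; exact: commutator_conjg. Qed.

Definition gamma3 : normalSubgroup G :=
  NormalSubgroup (commutator_subgroup _ _) gamma3_conjg.

End Gamma3.

Arguments gamma3 : clear implicits.

(* Injectivity of the basis b and generation of F by its image both follow
   from the universal property. *)
Definition free_on (X : Type) (F : groupType) (b : X -> F) : Prop :=
  forall (H : groupType) (f : X -> H),
    exists! phi : F -> H, {morph phi : x y / x * y} /\ phi \o b = f.

(* The rank is the cardinality of X. *)
Definition free_nilpotent2 (X : Type) (N : groupType) : Prop :=
  exists (F : groupType) (b : X -> F),
    free_on b /\ isomorphic N (quotient_group (gamma3 F)).

Record aut (G : groupType) := Automorphism {
  aut_fun :> G -> G;
  aut_morph : {morph aut_fun : x y / x * y};
  aut_bij : bijective aut_fun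
}.

Section Automorphisms.
Variable G : groupType.
Implicit Types f g h : aut G.

HB.instance Definition _ := gen_eqMixin (aut G).
HB.instance Definition _ := gen_choiceMixin (aut G).

Lemma aut_fun_inj f g : f =1 g -> f = g.
Proof.
case: f g => [f fM fB] [g gM gB] /= /funext fg; subst g.
by rewrite (Prop_irrelevance fM gM) (Prop_irrelevance fB gB).
Qed.

Lemma aut_fun1 f : f 1 = 1.
Proof. by apply: (mulgI (f 1)); rewrite -aut_morph !mulg1. Qed.

HB.instance Definition _ f := isMultiplicative.Build G G f (@aut_morph G f).
HB.instance Definition _ f :=
  Multiplicative_isUMagmaMorphism.Build G G f (aut_fun1 f).

Lemma aut_one_morph : {morph (@id G) : x y / x * y}. Proof. by []. Qed.
Definition aut_one : aut G := Automorphism aut_one_morph (inv_bij (fun=> erefl)).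

Lemma aut_mul_morph f g : {morph f \o g : x y / x * y}.
Proof. by move=> x y /=; rewrite !aut_morph. Qed.
Definition aut_mul f g : aut G :=
  Automorphism (aut_mul_morph f g) (bij_comp (aut_bij f) (aut_bij g)).

Lemma aut_inv_subproof f : exists g : G -> G, cancel f g /\ cancel g f.
Proof. by case: (aut_bij f) => g fK gK; exists g. Qed.
Definition aut_inv_fun f : G -> G := projT1 (cid (aut_inv_subproof f)).
Lemma aut_funK f : cancel f (aut_inv_fun f).
Proof. by rewrite /aut_inv_fun; case: cid => g []. Qed.
Lemma aut_inv_funK f : cancel (aut_inv_fun f) f.
Proof. by rewrite /aut_inv_fun; case: cid => g []. Qed.
Lemma aut_inv_morph f : {morph aut_inv_fun f : x y / x * y}.
Proof.
by move=> x y; apply: (can_inj (aut_funK f)); rewrite aut_morph !aut_inv_funK.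
Qed.
Definition aut_inv f : aut G :=
  Automorphism (@aut_inv_morph f) (Bijective (aut_inv_funK f) (aut_funK f)).

Lemma aut_mulA : associative aut_mul.
Proof. by move=> f g h; exact: aut_fun_inj. Qed.
Lemma aut_mul1g : left_id aut_one aut_mul.
Proof. by move=> f; exact: aut_fun_inj. Qed.
Lemma aut_mulg1 : right_id aut_one aut_mul.
Proof. by move=> f; exact: aut_fun_inj. Qed.
Lemma aut_mulVg : left_inverse aut_one aut_inv aut_mul.
Proof. by move=> f; apply: aut_fun_inj => x /=; rewrite aut_funK. Qed.
Lemma aut_mulgV : right_inverse aut_one aut_inv aut_mul.
Proof. by move=> f; apply: aut_fun_inj => x /=; rewrite aut_inv_funK. Qed.

HB.instance Definition _ := isGroup.Build (aut G)
  aut_mulA aut_mul1g aut_mulg1 aut_mulVg aut_mulgV.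

Definition is_inner (f : aut G) : Prop := exists a : G, forall x, f x = x ^ a.

Lemma is_inner_subgroup : is_subgroup is_inner.
Proof.
split; first by exists 1 => x; rewrite conjg1.
  by move=> f g [a fa] [b gb]; exists (b * a) => x; rewrite /= gb fa conjgM.
move=> f [a fa]; exists a^-1 => x.
by apply: (can_inj (aut_funK f)); rewrite aut_inv_funK fa conjgKV.
Qed.

Lemma is_inner_conjg f g : is_inner f -> is_inner (f ^ g).
Proof.
move=> [a fa]; exists (aut_inv_fun g a) => x.
apply: (can_inj (aut_funK g)).
by rewrite [LHS]aut_inv_funK /= fa gmulfJ /= aut_inv_funK.
Qed.

Definition inn : normalSubgroup (aut G) :=
  NormalSubgroup is_inner_subgroup is_inner_conjg.

End Automorphisms.

Arguments inn : clear implicits.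

Definition out (G : groupType) : groupType := quotient_group (inn G).

Definition center (G : groupType) : set G :=
  [set z | forall x, commute z x].
Arguments center : clear implicits.

Definition complete_group (G : groupType) : Prop :=
  center G = [set 1] /\ forall f : aut G, is_inner f.

(* Main.v *)
Require Import Defs.
From mathcomp Require Import all_boot.
From mathcomp Require Import boolp classical_sets functions cardinality.
From HB Require Import structures.
From mathcomp Require Import all_algebra finmap generic_quotient zify ring.
From mathcomp Require Import monalg.

Set Implicit Arguments.
Unset Strict Implicit.
Unset Printing Implicit Defensive.
Import GRing.Theory Num.Theory.
Local Open Scope ring_scope.
Local Open Scope quotient_scope.

(** Let [A] be the abelianization of [N], a free abelian group on [X], and [L]
    the derived subgroup of [N], which is the exterior square of [A]. The group
    Out(N) acts on [A], every automorphism of [A] is induced by one of [N], and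
    the elements acting trivially form an abelian normal subgroup
    V = Hom(A, L) / A, where [a] in [A] stands for the inner homomorphism
    [b |-> b /\ a]. An element acting as [g] conjugates [phi] to
    [(g /\ g)^-1 o phi o g]. The record [linearModel] collects these facts,
    [out_model] proves them, and the rest of the argument uses only them.

    The first step recognizes V and the transvections [a |-> a + eps(a) u] in
    the abstract group. If [[v, x, x, x] = 1] for every [v] in V, then [x] acts
    on [A] as the identity or as a transvection ([cubic_transvection]), while
    [[v, x, x] = 1] for every [v] excludes transvections. Hence V consists of
    the elements that commute with all their conjugates ([triv_self_comm]), and
    every automorphism preserves it. An element acting as [-1] inverts V, and
    V has no 2-torsion, so the center is trivial ([model_center]).

    Now let [al] be an automorphism. It maps elements acting as transvections to
    such elements. If [x] acts by [eps] and [u], the elements [[v, x, x]] are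
    twice [eps (x) (u /\ w)], so two transvections share a nontrivial element of
    this form only when their functionals are proportional. Hence [al] maps the
    group of transvections with functional [eps], a copy of the kernel of [eps],
    onto another such group ([aut_kernel]). This yields isomorphisms between
    hyperplanes of [A], which extend to automorphisms of [A]; composing [al] with
    conjugations, the transvections along two coordinate hyperplanes become fixed
    ([straighten], [straighten_two]). It follows that [al x] acts as [x] up to
    sign ([act_aut_sign]), and exactly as [x] for a transvection ([act_aut_tv]).
    Comparing the elements [[v, x, x]] once more shows that [al] is a homothety
    on V, by 1 or -1 ([aut_scalar]), and after conjugation by an element acting
    as [-1] it is the identity on V.

    What remains is the cocycle [x |-> x^-1 al(x)] with values in V. Since [-1]
    is central in GL(A), twice this cocycle is the coboundary of its value at
    [-1], and that value is invariant modulo 2. By [inner_of_contractions] it is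
    divisible by 2, so the cocycle itself is a coboundary and [al] is inner
    ([inner_of_fixing]). *)

(** * Homomorphisms of abelian groups *)

Definition is_add (U V : zmodType) (f : U -> V) := {morph f : x y / x + y}.

Section IsAdd.
Variables (U V : zmodType) (f : U -> V).
Hypothesis fD : is_add f.

Lemma add_map0 : f 0 = 0.
Proof. by apply: (addrI (f 0)); rewrite -fD !addr0. Qed.
Lemma add_mapN : {morph f : x / - x}.
Proof. by move=> x; apply: (addrI (f x)); rewrite -fD !subrr add_map0. Qed.
Lemma add_mapB : {morph f : x y / x - y}.
Proof. by move=> x y; rewrite fD add_mapN. Qed.
Lemma add_mapMz n : {morph f : x / x *~ n}.
Proof.
move=> x; case: n => n; last rewrite NegzE !mulrNz add_mapN; last congr (- _).
  by elim: n => [|n IH]; rewrite ?mulr0z ?add_map0 // !intS !mulrzDr fD IH.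
by elim: n.+1 => [|m IH]; rewrite ?mulr0z ?add_map0 // !intS !mulrzDr fD IH.
Qed.
Lemma add_map_inj : (forall x, f x = 0 -> x = 0) -> injective f.
Proof.
move=> f0 x y fxy; apply/subr0_eq/f0; by rewrite add_mapB fxy subrr.
Qed.
End IsAdd.

Lemma is_add_comp (U V W : zmodType) (f : V -> W) (g : U -> V) :
  is_add f -> is_add g -> is_add (f \o g).
Proof. by move=> fD gD x y /=; rewrite gD fD. Qed.

Lemma is_add_can (U V : zmodType) (f : U -> V) g :
  is_add f -> cancel f g -> cancel g f -> is_add g.
Proof. by move=> fD fK gK x y; apply: (can_inj fK); rewrite fD !gK. Qed.

Section PointwiseOperations.
Variables (U V : zmodType) (f g : U -> V).
Hypotheses (fD : is_add f) (gD : is_add g).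

Lemma is_addD : is_add (fun a => f a + g a).
Proof. by move=> a b; rewrite fD gD addrACA. Qed.
Lemma is_addN : is_add (fun a => - f a).
Proof. by move=> a b; rewrite fD opprD. Qed.
Lemma is_addMz n : is_add (fun a => f a *~ n).
Proof. by move=> a b; rewrite fD mulrzDl. Qed.
End PointwiseOperations.

Definition conj_all (T : Type) (P : T -> Prop) (s : seq T) :=
  foldr (fun x Q => P x /\ Q) True s.

(** * Free abelian groups *)

(** Coordinates and extension along the basis are kept as fields, so that
    proofs about an abstract [A] never unfold a representation. *)
Record freeAbelian (X : choiceType) := FreeAbelian {
  fa_sort :> zmodType;
  basis : X -> fa_sort;
  fa_coef : X -> fa_sort -> int;
  lift : forall V : zmodType, (X -> V) -> fa_sort -> V;
  fa_coef_is_add : forall i, is_add (fa_coef i);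
  fa_coef_basis : forall i j, fa_coef j (basis i) = (i == j)%:R;
  fa_coef_ext : forall a b, (forall i, fa_coef i a = fa_coef i b) -> a = b;
  lift_is_add : forall (V : zmodType) (h : X -> V), is_add (lift h);
  lift_basis : forall (V : zmodType) (h : X -> V) i, lift h (basis i) = h i;
  free_ind : forall P : fa_sort -> Prop,
    P 0 -> (forall a b, P a -> P b -> P (a + b)) -> (forall a, P a -> P (- a)) ->
    (forall i, P (basis i)) -> forall a, P a
}.

Section MalgFree.
Variable X : choiceType.
Local Notation A := {malg int[X]}.

Lemma malg_ind (P : A -> Prop) :
  P 0 -> (forall a b, P a -> P b -> P (a + b)) -> (forall a, P a -> P (- a)) ->
  (forall i, P << i >>) -> forall a, P a.
Proof.
move=> P0 PD PN Pe a; rewrite (monalgE a); apply: big_ind => // i _.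
have -> : << a@_i *g i >> = << i >> *~ a@_i :> A.
  by rewrite -(raddfMz (mkmalgU i)) intz.
have PM n : P (<< i >> *~ Posz n).
  by elim: n => [|n IH]; rewrite ?mulr0z // intS mulrzDr mulr1z; apply: PD.
by case: (a@_i) => n; rewrite ?NegzE ?mulrNz //; exact/PN/PM.
Qed.

Definition malg_lift (V : zmodType) (h : X -> V) (a : A) : V :=
  \sum_(i <- msupp a) h i *~ a@_i.

Lemma malg_lift_is_add (V : zmodType) (h : X -> V) : is_add (malg_lift h).
Proof.
have liftEw (d : {fset X}) a : (msupp a `<=` d)%fset ->
    malg_lift h a = \sum_(i <- d) h i *~ a@_i.
  move=> le; rewrite [LHS](big_fset_incl _ le) => //= i _ /mcoeff_outdom ->.
  by rewrite mulr0z.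
move=> a b; set d := (msupp a `|` msupp b)%fset.
rewrite (liftEw d) ?msuppD_le // (liftEw d a) ?fsubsetUl //.
rewrite (liftEw d b) ?fsubsetUr // -big_split; apply: eq_bigr => i _ /=.
by rewrite mcoeffD mulrzDr.
Qed.

Definition malg_free : freeAbelian X.
Proof.
apply: (@FreeAbelian X A (fun i => << i >>) (@mcoeff _ _) malg_lift) => //.
- by move=> i a b; rewrite mcoeffD.
- by move=> i j; rewrite mcoeffU.
- by move=> a b /malgP.
- exact: malg_lift_is_add.
- move=> V h i.
  by rewrite /malg_lift msuppU oner_eq0 big_seq_fset1 mcoeffU eqxx.
- exact: malg_ind.
Defined.
End MalgFree.

Section FreeAbelian.
Variables (X : choiceType) (A : freeAbelian X).
Local Notation "a @_ i" := (fa_coef i a).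
Implicit Types (a b : A) (i j : X).

Lemma fa_coefD i a b : (a + b)@_i = a@_i + b@_i. Proof. exact: fa_coef_is_add. Qed.
Lemma fa_coefN i a : (- a)@_i = - a@_i.
Proof. by rewrite (add_mapN (fa_coef_is_add i)). Qed.
Lemma fa_coef0 i : (0 : A)@_i = 0.
Proof. by rewrite (add_map0 (fa_coef_is_add i)). Qed.
Lemma fa_coefMz i a n : (a *~ n)@_i = n * a@_i.
Proof. by rewrite (add_mapMz (fa_coef_is_add i)) mulrzz mulrC. Qed.
Definition fa_coefE := (fa_coefD, fa_coefN, fa_coefMz, fa_coef0, fa_coef_basis).

Lemma basis_neq0 i : basis A i != 0.
Proof. by apply/eqP => /(congr1 (fa_coef i)); rewrite !fa_coefE eqxx. Qed.

Lemma neq0_coef a : a != 0 -> exists i, a@_i != 0.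
Proof.
move=> a0; apply: contrapT => /forallNP h; move/eqP: a0; apply.
by apply: fa_coef_ext => i; rewrite fa_coef0; apply/eqP/negPn/negP/h.
Qed.

Lemma eq_add_map (V : zmodType) (f g : A -> V) : is_add f -> is_add g ->
  (forall i, f (basis A i) = g (basis A i)) -> f =1 g.
Proof.
move=> fD gD fg; apply: free_ind => //.
- by rewrite !add_map0.
- by move=> a b fga fgb; rewrite fD gD fga fgb.
- by move=> a fga; rewrite !add_mapN // fga.
Qed.

Lemma finite_support a : exists s : {fset X}, forall i, i \notin s -> a@_i = 0.
Proof.
elim/free_ind: a => [|a b [s sP] [t tP]|a [s sP]|i].
- by exists fset0 => i _; rewrite fa_coef0.
- exists (s `|` t)%fset => i; rewrite in_fsetU negb_or => /andP[/sP ha /tP hb].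
  by rewrite fa_coefD ha hb.
- by exists s => i /sP ha; rewrite fa_coefN ha oppr0.
- by exists [fset i]%fset => j; rewrite in_fset1 fa_coef_basis eq_sym => /negPf->.
Qed.

(** Parallel vectors: proportional over the rationals. *)
Definition parallel a b := forall i j, a@_i * b@_j = a@_j * b@_i.

Lemma non_parallelP a b : ~ parallel a b ->
  exists i j, a@_i * b@_j != a@_j * b@_i.
Proof.
by move=> /existsNP[i /existsNP[j /eqP ab]]; exists i, j.
Qed.


Lemma indep_comb a b (m n : int) : ~ parallel a b ->
  a *~ m + b *~ n = 0 -> m = 0 /\ n = 0.
Proof.
move=> /non_parallelP[i [j ab]] mn.
have := congr1 (fa_coef i) mn; have := congr1 (fa_coef j) mn.
rewrite !fa_coefE => hj hi; split; apply/eqP.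
  suff : m * (a@_i * b@_j - a@_j * b@_i) == 0 by rewrite mulf_eq0 subr_eq0 (negPf ab) orbF.
  by apply/eqP; transitivity ((m * a@_i + n * b@_i) * b@_j - (m * a@_j + n * b@_j) * b@_i);
    [ring | rewrite hi hj !mul0r subrr].
suff : n * (a@_i * b@_j - a@_j * b@_i) == 0 by rewrite mulf_eq0 subr_eq0 (negPf ab) orbF.
by apply/eqP; transitivity ((m * a@_j + n * b@_j) * a@_i - (m * a@_i + n * b@_i) * a@_j);
  [ring | rewrite hi hj !mul0r subrr].
Qed.

Lemma parallel_trans a b c : b != 0 -> parallel a b -> parallel b c -> parallel a c.
Proof.
move=> /neq0_coef[k bk] ab bc i j; apply: (mulfI bk).
have h1 := ab i k; have h2 := bc k j; have h3 := ab j k; have h4 := bc k i.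
transitivity (a@_i * (b@_k * c@_j)); first by ring.
rewrite h2; transitivity ((a@_i * b@_j) * c@_k); first by ring.
rewrite ab; transitivity (a@_j * (b@_i * c@_k)); first by ring.
by rewrite -h4; ring.
Qed.

(** The ratios at two basis vectors agree because the sum of these vectors is
    also sent to a multiple of itself. *)
Lemma parallel_scalar (g : A -> A) : is_add g -> (forall a, parallel (g a) a) ->
  exists n : int, forall a, g a = a *~ n.
Proof.
move=> gD gp.
have ge i : exists n : int, g (basis A i) = (basis A i) *~ n.
  exists (g (basis A i))@_i; apply: fa_coef_ext => j; rewrite fa_coefMz fa_coef_basis.
  by have := gp (basis A i) i j; rewrite !fa_coef_basis eqxx /=; lia.
have [X0|/existsNP[i0 _]] := pselect (forall i : X, False).
  by exists 0; apply: eq_add_map => // a b; rewrite mulrzDl.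
have {ge}[c gc] := choice ge.
exists (c i0); apply: eq_add_map => [|a b|i]; rewrite ?mulrzDl //.
rewrite gc; have [-> //|ii0] := eqVneq i i0; congr (_ *~ _).
have := gp ((basis A i) + (basis A i0)) i i0.
by rewrite gD !gc !fa_coefD !fa_coefMz !fa_coef_basis !eqxx (negPf ii0) eq_sym (negPf ii0) /=; lia.
Qed.

(** The functional is divided by its least positive value, which generates its
    image. *)
Lemma primitive_functional (h : A -> int) a0 : is_add h -> h a0 != 0 ->
  exists (eps : A -> int) (d : int) p,
    [/\ is_add eps, d != 0, eps p = 1 & forall a, h a = d * eps a].
Proof.
move=> hD ha0.
pose P n := `[< exists a, h a = Posz n.+1 >].
have exP : exists n, P n.
  case E : (h a0) => [n|n].
    by move: ha0; rewrite E; case: n E => // n E _; exists n; apply/asboolP; exists a0.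
  by exists n; apply/asboolP; exists (- a0); rewrite (add_mapN hD) E NegzE opprK.
case: (ex_minnP exP) => d /asboolP[p hp] dmin.
have dvd a : (Posz d.+1 %| h a)%Z.
  apply: contrapT => /negP nd.
  have := divz_eq (h a) d.+1; set q := (_ %/ _)%Z; set r := (_ %% _)%Z => ha.
  have r_ge0 : 0 <= r by rewrite modz_ge0.
  have r_lt : r < d.+1 by rewrite ltz_pmod.
  have r0 : r != 0 by apply: contra nd => /eqP r0; apply/dvdz_mod0P.
  have hr : h (a - p *~ q) = r by rewrite (add_mapB hD) (add_mapMz hD) hp ha mulrzz; lia.
  case: r r_ge0 r_lt r0 hr {ha} => // -[|n] // _ nd1 _ hr.
  have /dmin : P n by apply/asboolP; exists (a - p *~ q).
  lia.
exists (fun a => (h a %/ Posz d.+1)%Z), d.+1, p; split => //.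
- by move=> a b; rewrite hD divzDl.
- by rewrite hp divzz.
- by move=> a; rewrite mulrC divzK.
Qed.

Definition fparallel (eps del : A -> int) := forall a b, eps a * del b = eps b * del a.

(** The ratio [del p] of the two functionals divides [del q = 1]. *)
Lemma fparallel_surj (eps del : A -> int) p q : fparallel eps del ->
  eps p = 1 -> del q = 1 ->
  (forall a, del a = eps a) \/ (forall a, del a = - eps a).
Proof.
move=> ed ep dq; have dE a : del a = eps a * del p by have := ed p a; rewrite ep mul1r.
have := dE q; rewrite dq => /esym dp.
have : `|del p|%N = 1%N.
  have : (`|eps q| * `|del p|)%N = 1%N by rewrite -abszM dp.
  by move/eqP; rewrite muln_eq1 => /andP[_ /eqP].
move=> dp1; have [{}dp1|{}dp1] : del p = 1 \/ del p = -1 by lia.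
  by left=> a; rewrite dE dp1 mulr1.
by right=> a; rewrite dE dp1 mulrN1.
Qed.

Lemma indep_separate a b : ~ parallel a b ->
  exists eps : A -> int, [/\ is_add eps, eps a = 0 & eps b != 0].
Proof.
move=> /non_parallelP[i [j ab]]; exists (fun c => a@_i * c@_j - a@_j * c@_i); split.
- by move=> c c'; rewrite !fa_coefE; ring.
- by ring.
- by rewrite subr_eq0.
Qed.

Section Infinite.
Variable nx : nat -> X.
Hypothesis nx_inj : injective nx.

Lemma fresh (s : {fset X}) : exists i, i \notin s.
Proof.
apply: contrapT => /forallNP h.
have hs n : nx n \in s by apply/negPn/negP/h.
have : (size [seq nx n | n <- iota 0 (size s).+1] <= size s)%N.
  apply: uniq_leq_size; first by rewrite map_inj_uniq ?iota_uniq.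
  by move=> _ /mapP[n _ ->].
by rewrite size_map size_iota ltnn.
Qed.

(** Infinite rank, in a form stable under passing to the kernel of a
    functional: a sequence of nonzero vectors with disjoint supports. *)
Let blocks (b : nat -> A) := (forall k, b k != 0) /\
  forall k l i, k != l -> (b k)@_i = 0 \/ (b l)@_i = 0.

(** Consecutive vectors are paired, and each pair has a nonzero combination
    killed by [eps]. *)
Let kill_blocks (b : nat -> A) (eps : A -> int) : is_add eps -> blocks b ->
  exists c, [/\ blocks c, forall k, eps (c k) = 0 &
    forall del : A -> int, is_add del ->
      (forall k, del (b k) = 0) -> forall k, del (c k) = 0].
Proof.
move=> epsD [b0 bd].
pose c k := if eps (b k.*2) == 0 then b k.*2
  else b k.*2 *~ eps (b k.*2.+1) - b k.*2.+1 *~ eps (b k.*2).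
exists c; split.
- split=> [k|k l i kl].
    rewrite /c; case: ifPn => [_|ek]; first exact: b0.
    have [i bi] := neq0_coef (b0 k.*2.+1).
    have [bi0|/eqP] := bd k.*2 k.*2.+1 i ltac:(lia); last by rewrite (negPf bi).
    apply/eqP => /(congr1 (fa_coef i)); rewrite !fa_coefE bi0 mulr0 sub0r => /eqP.
    by rewrite oppr_eq0 mulf_eq0 (negPf ek) (negPf bi).
  have c0 m : (b m.*2)@_i = 0 -> (b m.*2.+1)@_i = 0 -> (c m)@_i = 0.
    by move=> h1 h2; rewrite /c; case: ifP => _; rewrite ?fa_coefE ?h1 ?h2 ?mulr0 ?subr0.
  have [h1|h1] := eqVneq ((b k.*2)@_i) 0; last first.
    right; apply: c0.
      by have [/eqP|//] := bd k.*2 l.*2 i ltac:(lia); rewrite (negPf h1).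
    by have [/eqP|//] := bd k.*2 l.*2.+1 i ltac:(lia); rewrite (negPf h1).
  have [h2|h2] := eqVneq ((b k.*2.+1)@_i) 0; first by left; exact: c0.
  right; apply: c0.
    by have [/eqP|//] := bd k.*2.+1 l.*2 i ltac:(lia); rewrite (negPf h2).
  by have [/eqP|//] := bd k.*2.+1 l.*2.+1 i ltac:(lia); rewrite (negPf h2).
- move=> k; rewrite /c; case: eqP => // _.
  by rewrite (add_mapB epsD) !(add_mapMz epsD) !mulrzz mulrC subrr.
- move=> del delD db k; rewrite /c; case: ifP => // _.
  by rewrite (add_mapB delD) !(add_mapMz delD) !db !mul0rz subrr.
Qed.

Lemma common_kernel (s : seq (A -> int)) : conj_all (@is_add A int) s ->
  exists2 a, a != 0 & conj_all (fun eps => eps a = 0) s.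
Proof.
move=> sD; suff [b [[b0 _] bs]] : exists b : nat -> A, blocks b /\
    forall k, conj_all (fun eps => eps (b k) = 0) s by exists (b 0%N).
elim: s sD => [|eps s IH] /= sD.
  exists (fun k => basis A (nx k)); split=> //.
  split=> [k|k l i kl]; first exact: basis_neq0.
  rewrite !fa_coef_basis; case: eqP => [<-|_]; last by left.
  by right; rewrite (inj_eq nx_inj) eq_sym (negPf kl).
have [epsD {}sD] := sD; have [b [bb bs]] := IH sD.
have [c [cb ceps cdel]] := kill_blocks epsD bb.
exists c; split=> // k; split; first exact: ceps.
elim: s sD bs {IH} => //= del s IH [delD sD] bs; split.
  by apply: cdel => // l; have [] := bs l.
by apply: IH => // l; have [] := bs l.
Qed.
End Infinite.
End FreeAbelian.

Lemma fa_realize (X : choiceType) (A : freeAbelian X) (c : X -> int) (s : {fset X}) :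
  (forall i, i \notin s -> c i = 0) -> exists a : A, forall i, fa_coef i a = c i.
Proof.
move=> sc; exists (\sum_(i <- s) basis A i *~ c i) => j.
have sumE (r : seq X) : fa_coef j (\sum_(i <- r) basis A i *~ c i) =
    \sum_(i <- r) c i * (i == j)%:R.
  elim: r => [|i r IH]; first by rewrite !big_nil fa_coef0.
  by rewrite !big_cons fa_coefD IH fa_coefMz fa_coef_basis.
rewrite sumE; have [js|js] := boolP (j \in s).
  rewrite (big_fsetD1 j) //= eqxx mulr1 big1_fset ?addr0 // => i.
  by rewrite in_fsetD1 => /andP[/negPf-> _] _; rewrite mulr0.
rewrite (sc _ js) big1_fset // => i is_ _.
by case: eqP => [ij|_]; [rewrite ij (negPf js) in is_ | rewrite mulr0].
Qed.

(** * Classification of transvections *)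

Section Classification.
Variables (X : choiceType) (A : freeAbelian X) (nx : nat -> X).
Hypothesis nx_inj : injective nx.
Local Notation "a @_ i" := (fa_coef i a).
Implicit Types (a b u v : A) (i j k : X).

Definition minor i j a b : int := a@_i * b@_j - a@_j * b@_i.

Lemma parallel_minor a b : parallel a b <-> forall i j, minor i j a b = 0.
Proof.
split=> ab i j; first by rewrite /minor ab subrr.
by apply/eqP; rewrite -subr_eq0; apply/eqP/ab.
Qed.

Definition transvection (eps : A -> int) u (g : A -> A) :=
  [/\ is_add eps, exists p, eps p = 1, u != 0, eps u = 0 &
      forall a, g a = a + u *~ eps a].

Variable g : A -> A.
Hypothesis gD : is_add g.
Hypothesis g0 : forall a, g a = 0 -> a = 0.

(** In coordinates: on the tensor product of the exterior square with [A], the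
    cube of [1 (x) g - (g /\ g) (x) 1] vanishes. *)
Hypothesis g_cubic : forall i j k u v b,
  minor i j u v * (g (g (g b)))@_k - 3 * minor i j (g u) (g v) * (g (g b))@_k
  + 3 * minor i j (g (g u)) (g (g v)) * (g b)@_k
  - minor i j (g (g (g u))) (g (g (g v))) * b@_k = 0.

Let i0 := nx 0.
Let i1 := nx 1.
Let e0 := basis A i0.
Let e1 := basis A i1.

Let i01 : (i0 == i1) = false.
Proof. by rewrite (inj_eq nx_inj). Qed.

Let i10 : (i1 == i0) = false. Proof. by rewrite eq_sym i01. Qed.

Let minor01 : minor i0 i1 e0 e1 = 1.
Proof. by rewrite /minor /e0 /e1 !fa_coefE !eqxx i01 i10. Qed.

(** A homothety [n] satisfies [(n (1 - n))^3 = 0]. *)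
Let scalar_id : (forall a, parallel (g a) a) -> forall a, g a = a.
Proof.
move=> /(parallel_scalar gD)[n gn].
have n0 : n != 0.
  apply/eqP => n0; have := g0 (a := e0).
  by rewrite gn n0 mulr0z => /(_ erefl)/eqP; rewrite (negPf (basis_neq0 _ _)).
have := g_cubic i0 i1 i0 e0 e1 e0.
have minorZ m m' : minor i0 i1 (e0 *~ m) (e1 *~ m') = m * m'.
  by rewrite /minor /e0 /e1 !fa_coefE !eqxx i01 i10 /=; ring.
rewrite !gn -!mulrzA !minorZ minor01 /e0 !fa_coefE eqxx /= => h.
have : (n * (1 - n)) ^+ 3 = 0 by rewrite -[RHS]h; ring.
move/eqP; rewrite expf_eq0 /= mulf_eq0 (negPf n0) subr_eq0 /= => /eqP n1 a.
by rewrite gn -n1 mulr1z.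
Qed.

(** If [gu /\ gv = B (u /\ v)], then [B (gu /\ u /\ v) = 0], because [gu] is
    wedged with itself; a basis vector [v] outside the supports of [u] and [gu]
    then gives [gu /\ u = 0]. *)
Let minor_scalar B : (forall i j u v, minor i j (g u) (g v) = B * minor i j u v) ->
  forall a, g a = a.
Proof.
move=> gB; have B0 : B != 0.
  apply/eqP => B0; suff : e1 = 0 by apply/eqP/basis_neq0.
  apply: g0; apply: fa_coef_ext => i; rewrite fa_coef0.
  have : g (e0 *~ (g e1)@_i - e1 *~ (g e0)@_i) = 0.
    rewrite (add_mapB gD) !(add_mapMz gD); apply: fa_coef_ext => j; rewrite !fa_coefE.
    by have := gB j i e0 e1; rewrite B0 mul0r /minor; lia.
  move/g0/(congr1 (fa_coef i0)); rewrite /e0 /e1 !fa_coefE eqxx i10 /=; lia.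
apply: scalar_id => u i j.
have [s su] := finite_support u; have [t tu] := finite_support (g u).
have [k] := fresh nx_inj (s `|` t)%fset.
rewrite in_fsetU negb_or => /andP[/su uk /tu guk].
have mk l : minor l k u (basis A k) = u@_l.
  by rewrite /minor uk !fa_coefE eqxx mul0r subr0 mulr1.
have := gB j k u (basis A k); have := gB i k u (basis A k); rewrite !mk /minor guk.
set w := g (basis A k); rewrite !mul0r !subr0 => hi hj.
apply/eqP; rewrite -subr_eq0 -(mulrI_eq0 _ (mulfI B0)); apply/eqP.
transitivity ((g u)@_i * (B * u@_j) - (g u)@_j * (B * u@_i)); first by ring.
by rewrite -hi -hj; ring.
Qed.

(** The vector [b0 /\ g b0] is an eigenvector of [g /\ g] with eigenvalue
    [q = - t / r], the product of the roots of the quadratic polynomial. The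
    cubic identity on it reads [(g - q)^3 = 0], so both roots are [q], and
    [q = q^2] gives [q = 1]. Everything is multiplied by powers of [r] to stay
    over the integers. *)
Let quadratic (r s t : int) b0 : r != 0 -> ~ parallel b0 (g b0) ->
  (forall b, g (g b) *~ r = g b *~ s + b *~ t) ->
  forall b, g (g b) = g b *~ 2 - b.
Proof.
move=> r0 b0P q.
have qk b k : r * (g (g b))@_k = s * (g b)@_k + t * b@_k.
  by have := congr1 (fa_coef k) (q b); rewrite !fa_coefE.
have t0 : t != 0.
  apply/eqP => t0; have : g (g b0 *~ r - b0 *~ s) = 0.
    by rewrite (add_mapB gD) !(add_mapMz gD) q t0 mulr0z addr0 subrr.
  move/g0; rewrite addrC -mulrNz => /(indep_comb b0P)[_ /eqP].
  by rewrite (negPf r0).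
have [i [j ij]] := non_parallelP b0P.
set m := minor i j b0 (g b0).
have m0 : m != 0 by rewrite subr_eq0.
have m1 b : r * minor i j (g b) (g (g b)) = - t * minor i j b (g b).
  transitivity ((g b)@_i * (r * (g (g b))@_j) - (g b)@_j * (r * (g (g b))@_i)).
    by rewrite /minor; ring.
  by rewrite !qk /minor; ring.
have cub k : r ^+ 3 * (g (g (g b0)))@_k + 3 * r ^+ 2 * t * (g (g b0))@_k
    + 3 * r * t ^+ 2 * (g b0)@_k + t ^+ 3 * b0@_k = 0.
  apply/eqP; rewrite -(mulrI_eq0 _ (mulfI m0)); apply/eqP.
  have h1 := m1 b0; have h2 := m1 (g b0); have h3 := m1 (g (g b0)).
  have := g_cubic i j k b0 (g b0) b0; rewrite -/m.
  move: h1 h2 h3; rewrite -/m.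
  set x1 := minor _ _ _ _; set x2 := minor _ _ _ _; set x3 := minor _ _ _ _.
  move=> h1 h2 h3 h.
  have r2 : r ^+ 2 * x2 = t ^+ 2 * m.
    by transitivity (r * (r * x2)); [ring|rewrite h2 mulrCA h1; ring].
  have r3 : r ^+ 3 * x3 = - t ^+ 3 * m.
    transitivity (r ^+ 2 * (r * x3)); first by ring.
    by rewrite h3 mulrCA r2; ring.
  transitivity (m * r ^+ 3 * (g (g (g b0)))@_k - 3 * r ^+ 2 * (r * x1) * (g (g b0))@_k
    + 3 * r * (r ^+ 2 * x2) * (g b0)@_k - (r ^+ 3 * x3) * b0@_k).
    by rewrite h1 r2 r3; ring.
  by rewrite -[RHS](mulr0 (r ^+ 3)) -[in RHS]h; ring.
have [] : t ^+ 3 + 3 * r * t ^+ 2 + r * s * t = 0 /\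
    r * (s ^+ 2 + r * t + 3 * t * s + 3 * t ^+ 2) = 0.
  apply: (indep_comb b0P); apply: fa_coef_ext => k; rewrite !fa_coefE -[RHS](cub k).
  have q1 := qk b0 k; have q2 := qk (g b0) k.
  transitivity (r * (s * (s * (g b0)@_k + t * b0@_k) + r * t * (g b0)@_k)
    + 3 * r * t * (s * (g b0)@_k + t * b0@_k) + 3 * r * t ^+ 2 * (g b0)@_k
    + t ^+ 3 * b0@_k); first by ring.
  rewrite -q1.
  transitivity (r ^+ 2 * (s * (g (g b0))@_k + t * (g b0)@_k)
    + 3 * r ^+ 2 * t * (g (g b0))@_k + 3 * r * t ^+ 2 * (g b0)@_k + t ^+ 3 * b0@_k).
    by ring.
  by rewrite -q2; ring.
move=> h1 h2.
have {}h1 : t ^+ 2 + 3 * r * t + r * s = 0.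
  by apply: (mulfI t0); rewrite mulr0 -[RHS]h1; ring.
have {}h2 : s ^+ 2 + r * t + 3 * t * s + 3 * t ^+ 2 = 0.
  by apply: (mulfI r0); rewrite mulr0 -[RHS]h2; ring.
have rs : r * s = - t ^+ 2 - 3 * r * t by rewrite -[LHS]subr0 -h1; ring.
have : t * (t + r) ^+ 3 = 0.
  transitivity ((- t ^+ 2 - 3 * r * t) ^+ 2 + r ^+ 3 * t
    + 3 * t * r * (- t ^+ 2 - 3 * r * t) + 3 * t ^+ 2 * r ^+ 2); first by ring.
  by rewrite -rs -[RHS](mulr0 (r ^+ 2)) -[in RHS]h2; ring.
move/eqP; rewrite mulf_eq0 (negPf t0) expf_eq0 /= addr_eq0 => /eqP tr.
have sr : s = 2 * r by apply: (mulfI r0); rewrite rs tr; ring.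
move=> b; apply: fa_coef_ext => k; apply: (mulfI r0).
by rewrite qk sr tr !fa_coefE; ring.
Qed.

(** Let [n = g - 1]. As [n^2 = 0], the cubic identity at [b0] says that
    [g /\ g - 1] has square zero; this square sends [u /\ v] to
    [2 (nu /\ nv)], so [n] has rank one. *)
Let square_zero b0 : ~ parallel b0 (g b0) -> (forall b, g (g b) = g b *~ 2 - b) ->
  exists eps u, transvection eps u g.
Proof.
move=> b0P q.
pose n a := g a - a.
have nD : is_add n by move=> a b; rewrite /n gD opprD addrACA.
have nn a : n (n a) = 0.
  rewrite /n (add_mapB gD) q; apply: fa_coef_ext => k; rewrite !fa_coefE; ring.
have nP u v : parallel (n u) (n v).
  apply/parallel_minor => i j.
  have qk a k : (g (g a))@_k = 2 * (g a)@_k - a@_k by rewrite q !fa_coefE.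
  have [h _] : 3 * (minor i j u v - 2 * minor i j (g u) (g v)
        + minor i j (g (g u)) (g (g v))) = 0 /\
      - minor i j (g (g (g u))) (g (g (g v))) - 2 * minor i j u v
      + 3 * minor i j (g u) (g v) = 0.
    apply: (indep_comb (a := g b0) (b := b0)).
      by move=> p; apply: b0P => k l; rewrite (mulrC b0@_k) (mulrC b0@_l) p.
    apply: fa_coef_ext => k; rewrite !fa_coefE -[RHS](g_cubic i j k u v b0) !(qk _ k); ring.
  suff : 6 * minor i j (n u) (n v) = 0 by lia.
  rewrite -[RHS]h /n /minor !fa_coefE !qk; ring.
have [k nk] : exists k, (n b0)@_k != 0.
  apply: neq0_coef; apply: contra_notN b0P; rewrite subr_eq0 => /eqP -> i j; ring.
have [||eps [d [p [epsD d0 p1 hE]]]] := primitive_functional (h := fun a => (n a)@_k) (a0 := b0).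
- by move=> a b; rewrite nD fa_coefD.
- by [].
have pk : (n p)@_k = d by rewrite hE p1 mulr1.
have gE a : g a = a + n p *~ eps a.
  apply/eqP; rewrite addrC -subr_eq -/(n a); apply/eqP/fa_coef_ext => j.
  apply: (mulfI d0); have := nP p a k j; rewrite pk => ->.
  by rewrite hE fa_coefMz; ring.
exists eps, (n p); split=> //; first by exists p.
  by apply: contra_neq d0 => np0; rewrite -pk np0 fa_coef0.
by apply: (mulfI d0); rewrite mulr0 -hE nn fa_coef0.
Qed.

(** A pair where the minor is 1 turns the cubic identity into a monic cubic
    equation for [g]. Subtracting multiples of it from the identities at the
    other pairs leaves quadratic equations for [g]; their leading coefficients
    all vanish only if [g /\ g] is a homothety. *)
Lemma cubic_transvection : (forall a, g a = a) \/ exists eps u, transvection eps u g.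
Proof.
have [sc|/existsNP[b0 b0P]] := pselect (forall a, parallel a (g a)).
  left; apply: scalar_id => a i j; have := sc a j i; lia.
set B := minor i0 i1 (g e0) (g e1).
have [?|] := pselect (forall i j u v, minor i j (g u) (g v) = B * minor i j u v).
  by left; apply: (minor_scalar (B := B)).
move=> /existsNP[i /existsNP[j /existsNP[u /existsNP[v /eqP uv]]]]; right.
apply: (square_zero b0P).
pose m (n : nat) := minor i j (iter n g u) (iter n g v)
  - minor i0 i1 (iter n g e0) (iter n g e1) * minor i j u v.
apply: (@quadratic (3 * m 1%N) (3 * m 2%N) (- m 3%N) b0) => //.
  by rewrite mulf_eq0 /= /m /= subr_eq0 -/B.
move=> b; apply: fa_coef_ext => k; rewrite !fa_coefE.
have h1 := g_cubic i j k u v b; have := g_cubic i0 i1 k e0 e1 b.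
rewrite minor01 mul1r => h2; apply/eqP; rewrite -subr_eq0; apply/eqP.
transitivity (minor i j u v * 0 - 0 : int); last by rewrite mulr0 subr0.
by rewrite -[in X in _ = X - _]h2 -[in X in _ = _ - X]h1 /m /=; ring.
Qed.
End Classification.

(** * Exterior squares *)

(** [iota eps] is the contraction [a /\ b |-> eps(a) b - eps(b) a]. The last field
    says that an element is divisible by [m] when all its coordinates are; for
    [m = 0] this is the injectivity of the coordinates. *)
Record exteriorSquare (X : choiceType) (A : freeAbelian X) := ExteriorSquare {
  es_sort :> zmodType;
  wedge : A -> A -> es_sort;
  iota : (A -> int) -> es_sort -> A;
  wedgeDl : forall b, is_add (wedge^~ b);
  wedgeDr : forall a, is_add (wedge a);
  wedgexx : forall a, wedge a a = 0;
  iota_is_add : forall eps, is_add (iota eps);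
  iota_wedge : forall eps, is_add eps ->
    forall a b, iota eps (wedge a b) = b *~ eps a - a *~ eps b;
  es_ind : forall P : es_sort -> Prop,
    P 0 -> (forall z t, P z -> P t -> P (z + t)) -> (forall z, P z -> P (- z)) ->
    (forall a b, P (wedge a b)) -> forall z, P z;
  es_div : forall (m : int) (z : es_sort),
    (forall i j, (m %| fa_coef j (iota (fa_coef i) z))%Z) ->
    exists t, z = t *~ m
}.

Section ExteriorSquare.
Variables (X : choiceType) (A : freeAbelian X) (L : exteriorSquare A).
Local Notation "a @_ i" := (fa_coef i a).
Local Notation e := (basis A).
Implicit Types (a b u v : A) (i j k : X) (z t : L).

Definition es_coef i j z : int := (iota (fa_coef i) z)@_j.

Lemma es_coef_is_add i j : is_add (es_coef i j).
Proof. by move=> z t; rewrite /es_coef iota_is_add fa_coefD. Qed.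

Lemma es_coefD i j z t : es_coef i j (z + t) = es_coef i j z + es_coef i j t.
Proof. exact: es_coef_is_add. Qed.
Lemma es_coefN i j z : es_coef i j (- z) = - es_coef i j z.
Proof. exact: (add_mapN (@es_coef_is_add i j)). Qed.
Lemma es_coef0 i j : es_coef i j 0 = 0.
Proof. exact: (add_map0 (@es_coef_is_add i j)). Qed.
Lemma es_coefMz i j z n : es_coef i j (z *~ n) = n * es_coef i j z.
Proof. by rewrite (add_mapMz (@es_coef_is_add i j)) mulrzz mulrC. Qed.

Lemma es_coef_wedge i j a b : es_coef i j (wedge L a b) = minor i j a b.
Proof.
by rewrite /es_coef iota_wedge; [rewrite /minor !fa_coefE; ring | exact: fa_coef_is_add].
Qed.

Definition es_coefE := (es_coefD, es_coefN, es_coefMz, es_coef0, es_coef_wedge).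

Lemma es_coef_ext z t : (forall i j, es_coef i j z = es_coef i j t) -> z = t.
Proof.
move=> zt; apply/eqP; rewrite -subr_eq0; apply/eqP.
have [|y ->] := es_div (m := 0) (z := z - t); last exact: mulr0z.
by move=> i j; rewrite dvd0z -/(es_coef i j (z - t)) !es_coefE zt subrr.
Qed.

Lemma es_coef_sym i j z : es_coef j i z = - es_coef i j z.
Proof.
elim/es_ind: z => [|z t hz ht|z hz|a b].
- by rewrite !es_coef0 oppr0.
- by rewrite !es_coefD hz ht opprD.
- by rewrite !es_coefN hz.
- by rewrite !es_coef_wedge /minor; ring.
Qed.

Lemma es_coef_diag i z : es_coef i i z = 0.
Proof. have := es_coef_sym i i z; lia. Qed.

Lemma es_coef_finite z : exists s : {fset X}, forall i j, i \notin s -> es_coef i j z = 0.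
Proof.
elim/es_ind: z => [|z t [s sP] [s' tP]|z [s sP]|a b].
- by exists fset0 => i j _; rewrite es_coef0.
- exists (s `|` s')%fset => i j; rewrite in_fsetU negb_or => /andP[hs hs'].
  by rewrite es_coefD sP // tP // addr0.
- by exists s => i j hi; rewrite es_coefN sP // oppr0.
- have [s sP] := finite_support a; have [s' tP] := finite_support b.
  exists (s `|` s')%fset => i j; rewrite in_fsetU negb_or => /andP[hs hs'].
  by rewrite es_coef_wedge /minor (sP i) // (tP i) // mul0r mulr0 subr0.
Qed.

Lemma es_torsion_free z (n : int) : n != 0 -> z *~ n = 0 -> z = 0.
Proof.
move=> n0 zn; apply: es_coef_ext => i j; rewrite es_coef0; apply: (mulfI n0).
by rewrite mulr0 -es_coefMz zn es_coef0.
Qed.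

Lemma neq0_es_coef z : z != 0 -> exists i j, es_coef i j z != 0.
Proof.
move=> z0; apply: contrapT => /forallNP h; move/eqP: z0; apply.
apply: es_coef_ext => i j; rewrite es_coef0; apply: contrapT => /eqP ij.
by apply: (h i); exists j.
Qed.

Lemma wedgeC a b : wedge L a b = - wedge L b a.
Proof. by apply: es_coef_ext => i j; rewrite !es_coefE /minor; ring. Qed.

Lemma wedge0r a : wedge L a 0 = 0. Proof. exact: (add_map0 (@wedgeDr _ _ L a)). Qed.
Lemma wedge0l b : wedge L 0 b = 0. Proof. exact: (add_map0 (@wedgeDl _ _ L b)). Qed.
Lemma wedgeNr a b : wedge L a (- b) = - wedge L a b.
Proof. exact: (add_mapN (@wedgeDr _ _ L a)). Qed.
Lemma wedgeNl a b : wedge L (- a) b = - wedge L a b.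
Proof. exact: (add_mapN (@wedgeDl _ _ L b)). Qed.
Lemma wedgeMzr a b n : wedge L a (b *~ n) = wedge L a b *~ n.
Proof. exact: (add_mapMz (@wedgeDr _ _ L a)). Qed.

Lemma wedge_eq0 a b : wedge L a b = 0 -> parallel a b.
Proof. by move=> ab; apply/parallel_minor => i j; rewrite -es_coef_wedge ab es_coef0. Qed.

(** The hypothesis at basis vectors leaves only the coordinates of
    [phi (e j)] along [e i /\ e j], and at sums of two basis vectors it makes
    them independent of [j]: they are the coordinates of [- a]. The case
    [m = 0] identifies the action of an automorphism on the homomorphisms, and
    [m = 2] divides a cocycle by two. *)
Lemma inner_of_contractions (m : int) (phi : A -> L) (i0 i1 : X) : i0 != i1 ->
  is_add phi ->
  (forall i u, u@_i = 0 -> forall k l,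
    (m %| minor k l u (iota (fa_coef i) (phi u)))%Z) ->
  exists a psi, is_add psi /\ forall b, phi b = wedge L b a + psi b *~ m.
Proof.
move=> i01 phiD H.
have off i j l : i != j -> l != j -> (m %| es_coef i l (phi (e j)))%Z.
  move=> ij lj; have := H i (e j) _ j l; rewrite fa_coef_basis eq_sym (negPf ij).
  move=> /(_ erefl); rewrite /minor -!/(es_coef _ _ _) !fa_coef_basis eqxx eq_sym (negPf lj).
  by rewrite mul1r mul0r subr0.
have same i j k : i != j -> i != k ->
    (m %| es_coef i j (phi (e j)) - es_coef i k (phi (e k)))%Z.
  move=> ij ik; have [-> |jk] := eqVneq j k; first by rewrite subrr dvdz0.
  have := H i (e j + e k) _ k j; rewrite !fa_coefE eq_sym (negPf ij) eq_sym (negPf ik).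
  move=> /(_ erefl); rewrite /minor -!/(es_coef _ _ _) !fa_coefE !eqxx.
  rewrite (negPf jk) eq_sym (negPf jk) /= addr0 add0r !mul1r phiD !es_coefD.
  have d1 : (m %| es_coef i j (phi (e k)))%Z by apply: off.
  have d2 : (m %| es_coef i k (phi (e j)))%Z by apply: off; rewrite // eq_sym.
  set y := _ - _; have -> : y = (es_coef i j (phi (e j)) - es_coef i k (phi (e k)))
     + (es_coef i j (phi (e k)) - es_coef i k (phi (e j))) by rewrite /y; ring.
  by rewrite rpredDr //; apply: rpredB.
(* For [i0] itself another index must play the role of [j]. *)
pose c i := if i == i0 then - es_coef i0 i1 (phi (e i1)) else - es_coef i i0 (phi (e i0)).
have [a ac] : exists a : A, forall i, a@_i = c i.
  have [s sP] := es_coef_finite (phi (e i0)).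
  apply: (@fa_realize _ _ c (i0 |` s)%fset) => i.
  rewrite in_fset1U negb_or /c => /andP[/negPf-> /sP->]; exact: oppr0.
have cE i j : i != j -> (m %| es_coef i j (phi (e j)) + a@_i)%Z.
  move=> ij; rewrite ac /c; have [ii0|ii0] := eqVneq i i0; last exact: same.
  by rewrite -ii0; apply: same; rewrite // ii0.
have tP j : exists t : L, phi (e j) - wedge L (e j) a = t *~ m.
  apply: es_div => k l; rewrite -/(es_coef k l _) es_coefD es_coefN es_coef_wedge /minor !fa_coef_basis.
  have [jk|jk] := eqVneq j k; have [jl|jl] := eqVneq j l.
  - by rewrite -jk -jl es_coef_diag !subrr dvdz0.
  - rewrite -jk es_coef_sym.
    have -> : - es_coef l j (phi (e j)) - (true%:R * a@_l - false%:R * a@_j)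
      = - (es_coef l j (phi (e j)) + a@_l) by rewrite /=; ring.
    by rewrite rpredN; apply: cE; rewrite eq_sym.
  - rewrite -jl.
    have -> : es_coef k j (phi (e j)) - (false%:R * a@_j - true%:R * a@_k)
      = es_coef k j (phi (e j)) + a@_k by rewrite /=; ring.
    by apply: cE; rewrite eq_sym.
  - by rewrite !mul0r subrr subr0; apply: off; rewrite eq_sym.
have {tP}[t tP] := choice tP.
exists a, (lift t); split; first exact: lift_is_add.
move=> b; apply/eqP; rewrite -subr_eq0 opprD addrA subr_eq0; apply/eqP.
move: b; apply: eq_add_map.
- by move=> b b'; rewrite phiD wedgeDl opprD addrACA.
- by move=> b b'; rewrite lift_is_add mulrzDl.
- by move=> j; rewrite lift_basis tP.
Qed.

End ExteriorSquare.

(** * Extensions of GL(A) by Hom(A, L) / A *)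

(** [act] and [eact] are the actions on [A] and [L], and [ia] sends a homomorphism
    [phi] to the class of the automorphism [x |-> x phi(x)]. *)
Record linearModel (X : choiceType) (A : freeAbelian X) (L : exteriorSquare A)
    (G : groupType) := LinearModel {
  act : G -> A -> A;
  eact : G -> L -> L;
  ia : (A -> L) -> G;
  act_is_add : forall x, is_add (act x);
  act1 : forall a, act 1%g a = a;
  actM : forall x y a, act (x * y)%g a = act x (act y a);
  act_onto : forall g h : A -> A, is_add g -> cancel g h -> cancel h g ->
    exists x, forall a, act x a = g a;
  eact_is_add : forall x, is_add (eact x);
  eact_wedge : forall x a b, eact x (wedge L a b) = wedge L (act x a) (act x b);
  act_ia : forall phi, is_add phi -> forall a, act (ia phi) a = a;
  act_trivial : forall x, (forall a, act x a = a) ->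
    exists2 phi, is_add phi & x = ia phi;
  iaD : forall phi psi, is_add phi -> is_add psi ->
    ia (fun b => phi b + psi b) = (ia phi * ia psi)%g;
  ia_eq1 : forall phi, is_add phi ->
    (ia phi = 1%g <-> exists a, forall b, phi b = wedge L b a);
  iaJ : forall phi x, is_add phi ->
    (ia phi ^ x)%g = ia (fun b => eact x^-1%g (phi (act x b)))
}.

Section Model.
Variables (X : choiceType) (A : freeAbelian X) (L : exteriorSquare A).
Variables (G : groupType) (M : linearModel L G).
Variable nx : nat -> X.
Hypothesis nx_inj : injective nx.
Local Notation "a @_ i" := (fa_coef i a).
Local Notation e := (basis A).
Local Notation wedge := (wedge L).
Local Notation act := (act M).
Local Notation eact := (eact M).
Local Notation ia := (ia M).
Implicit Types (a b u v w : A) (i j k : X) (z t : L) (x y : G) (phi psi : A -> L).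
Implicit Types (eps del : A -> int).

Lemma actK x : cancel (act x) (act x^-1%g).
Proof. by move=> a; rewrite -actM mulVg act1. Qed.
Lemma actVK x : cancel (act x^-1%g) (act x).
Proof. by move=> a; rewrite -actM mulgV act1. Qed.
Lemma act_inj x : injective (act x). Proof. exact: can_inj (actK x). Qed.
Lemma act_eqV x y : (forall a, act x a = act y a) ->
  forall a, act x^-1%g a = act y^-1%g a.
Proof. by move=> xy a; apply: (@act_inj x); rewrite actVK xy actVK. Qed.
Lemma eact_eq x y : (forall a, act x a = act y a) -> forall z, eact x z = eact y z.
Proof.
move=> xy; apply: es_ind => [|z t hz ht|z hz|a b].
- by rewrite !(add_map0 (eact_is_add M _)).
- by rewrite !(eact_is_add M) hz ht.
- by rewrite !(add_mapN (eact_is_add M _)) hz.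
- by rewrite !eact_wedge !xy.
Qed.

Lemma ia_ext phi psi : phi =1 psi -> ia phi = ia psi.
Proof. by move=> /funext->. Qed.

Lemma ia0 : ia (fun=> 0) = 1%g.
Proof.
apply/ia_eq1; first by move=> a b; rewrite addr0.
by exists 0 => b; rewrite wedge0r.
Qed.

Lemma is_addJ phi x : is_add phi -> is_add (fun b => eact x^-1%g (phi (act x b))).
Proof. by move=> phiD a b; rewrite (act_is_add M) phiD (eact_is_add M). Qed.
Lemma is_add_rank1 eps z : is_add eps -> is_add (fun b => z *~ eps b).
Proof. by move=> epsD a b; rewrite epsD mulrzDr. Qed.

Lemma iaN phi : is_add phi -> ia (fun b => - phi b) = (ia phi)^-1%g.
Proof.
move=> phiD; apply: (mulgI (ia phi)); rewrite mulgV -iaD //; last exact: is_addN.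
by rewrite -ia0; apply: ia_ext => b; rewrite subrr.
Qed.

Lemma ia_inj phi psi : is_add phi -> is_add psi -> ia phi = ia psi ->
  exists a, forall b, phi b - psi b = wedge b a.
Proof.
move=> phiD psiD pp; apply/(ia_eq1 M).
  by apply: is_addD => //; apply: is_addN.
by rewrite iaD ?iaN ?pp ?mulgV //; apply: is_addN.
Qed.

(** [hom_comm x] is the effect of commutation with [x] on homomorphisms. *)
Definition hom_comm x phi := fun b => eact x^-1%g (phi (act x b)) - phi b.

Lemma is_add_hom_comm x phi : is_add phi -> is_add (hom_comm x phi).
Proof.
by move=> phiD; apply: is_addD; [apply: is_addJ|apply: is_addN].
Qed.

Lemma comm_ia phi x : is_add phi -> [~ ia phi, x]%g = ia (hom_comm x phi).
Proof.
move=> phiD; rewrite commgEl iaJ // -iaN // -iaD; last by apply: is_addJ.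
  by apply: ia_ext => b; rewrite addrC.
exact: is_addN.
Qed.

Definition triv x := forall a, act x a = a.

Lemma triv_comm x y : triv x -> triv y -> commute x y.
Proof.
move=> /act_trivial[phi phiD ->] /act_trivial[psi psiD ->].
by rewrite /commute -!iaD //; apply: ia_ext => b; rewrite addrC.
Qed.

Lemma triv1 : triv 1%g. Proof. by move=> a; rewrite act1. Qed.
Lemma trivM x y : triv x -> triv y -> triv (x * y)%g.
Proof. by move=> hx hy a; rewrite actM hy hx. Qed.
Lemma trivV x : triv x -> triv x^-1%g.
Proof. by move=> hx a; rewrite -[in LHS](hx a) actK. Qed.
Lemma trivJ x y : triv x -> triv (x ^ y)%g.
Proof. by move=> hx a; rewrite !actM hx actK. Qed.
Lemma triv_ia phi : is_add phi -> triv (ia phi).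
Proof. by move=> phiD a; rewrite act_ia. Qed.
Lemma triv_comm_x x y : triv x -> triv [~ x, y]%g.
Proof. by move=> hx; apply: trivM; [exact: trivV|exact: trivJ]. Qed.

(** For [a != 0] the homomorphism [b |-> b /\ a] has infinite rank, so it cannot
    vanish on the common kernel of finitely many functionals. *)
Lemma finite_rank_inner (s : seq (A -> int)) phi a : conj_all (@is_add A int) s ->
  (forall b, conj_all (fun eps => eps b = 0) s -> phi b = 0) ->
  (forall b, phi b = wedge b a) -> a = 0.
Proof.
move=> sD phi0 phia; apply: contrapT => /eqP/neq0_coef[i ai].
have [|b b0 [bi bs]] := @common_kernel _ A _ nx_inj ((fun a => a@_i) :: s).
  by split=> //; exact: fa_coef_is_add.
have [j bj] := neq0_coef b0.
have := phia b; rewrite phi0 // => /esym/(congr1 (es_coef j i)).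
rewrite es_coef_wedge es_coef0 /minor bi mul0r subr0 => /eqP.
by rewrite mulf_eq0 (negPf bj) (negPf ai).
Qed.

Lemma rank1_inj eps z t : is_add eps ->
  ia (fun b => z *~ eps b) = ia (fun b => t *~ eps b) ->
  forall b, z *~ eps b = t *~ eps b.
Proof.
move=> epsD /ia_inj[||a aP b]; try exact: is_add_rank1.
have a0 : a = 0.
  apply: (finite_rank_inner (s := [:: eps]) _ _ aP) => //.
  by move=> c [-> _]; rewrite !mulr0z subrr.
by apply/eqP; rewrite -subr_eq0 aP a0 wedge0r.
Qed.

(** Applied to the homomorphism [b |-> b_k z] with [z] in [L], the triple
    commutator is a homomorphism of finite rank, so it vanishes and not only
    modulo inner homomorphisms. Its coordinates are the cubic identity of
    [cubic_transvection]. *)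
Lemma triple_comm_transvection x :
  (forall v : G, triv v -> [~ v, x, x, x]%g = 1%g) ->
  triv x \/ exists eps u, transvection eps u (act x).
Proof.
move=> H; apply: (cubic_transvection nx_inj (act_is_add M x)).
  move=> a a0; apply: (@act_inj x); rewrite a0.
  by rewrite (add_map0 (act_is_add M x)).
move=> i j k u v b.
set g := act x; pose W n := wedge (iter n g u) (iter n g v).
have EW n : eact x^-1%g (W n.+1) = W n by rewrite eact_wedge /= !actK.
pose phi b := W 3%N *~ b@_k.
have phiD : is_add phi by apply: is_add_rank1; apply: fa_coef_is_add.
have dE c n m : eact x^-1%g (W n.+1 *~ c@_k *~ m) = W n *~ c@_k *~ m.
  by rewrite !(add_mapMz (eact_is_add M _)) EW.
have d3 c : hom_comm x (hom_comm x (hom_comm x phi)) c = W 0%N *~ (g (g (g c)))@_k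
    - W 1%N *~ (g (g c))@_k *~ 3 + W 2%N *~ (g c)@_k *~ 3 - W 3%N *~ c@_k.
  have E := eact_is_add M x^-1%g.
  rewrite /hom_comm /phi !(add_mapB E) !(add_mapMz E) !EW -/g.
  apply: es_coef_ext => p q; rewrite !es_coefE; ring.
have {}H : ia (hom_comm x (hom_comm x (hom_comm x phi))) = 1%g.
  have d1D := is_add_hom_comm x phiD; have d2D := is_add_hom_comm x d1D.
  by rewrite -!comm_ia // H //; exact: triv_ia.
have d3D : is_add (hom_comm x (hom_comm x (hom_comm x phi))) by do 3!apply: is_add_hom_comm.
have [a aP] := (ia_eq1 M d3D).1 H.
have a0 : a = 0.
  pose s n c := (iter n g c)@_k.
  have gnD n : is_add (iter n g).
    by elim: n => [|n IH] c d //=; rewrite IH /g (act_is_add M).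
  have sD n : is_add (s n) by move=> c d; rewrite /s gnD fa_coefD.
  apply: (finite_rank_inner (s := [:: s 0%N; s 1%N; s 2%N; s 3%N]) _ _ aP).
    by [].
  by move=> c; rewrite d3 /s /= => -[-> [-> [-> [-> _]]]];
    rewrite !(mulr0z, mul0rz) !(subrr, addr0).
have := congr1 (es_coef i j) (aP b); rewrite a0 d3 wedge0r.
by rewrite !es_coefE /= => h; rewrite -[RHS]h; ring.
Qed.

End Model.

(** * Double commutators with transvections *)
Section Transvections.
Variables (X : choiceType) (A : freeAbelian X) (L : exteriorSquare A).
Variables (G : groupType) (M : linearModel L G).
Variable nx : nat -> X.
Hypothesis nx_inj : injective nx.
Local Notation "a @_ i" := (fa_coef i a).
Local Notation e := (basis A).
Local Notation wedge := (wedge L).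
Local Notation act := (act M).
Local Notation eact := (eact M).
Local Notation ia := (ia M).
Local Notation hom_comm := (hom_comm M).
Local Notation triv := (triv M).
Implicit Types (a b u v w : A) (i j k : X) (z t : L) (x y : G) (phi psi : A -> L).
Implicit Types (eps del : A -> int).


(** Surjectivity determines a functional up to sign by its kernel, and it lets a
    transvection [tv eps u] determine [u]. *)
Definition functional eps := is_add eps /\ exists p, eps p = 1.

Lemma functional_coef i : functional (fa_coef i).
Proof.
by split; [exact: fa_coef_is_add | exists (e i); rewrite fa_coef_basis eqxx].
Qed.

(** Unlike in [transvection], [u] may be zero, which makes [u |-> tv eps u]
    additive. *)
Definition tv eps u x := forall b, act x b = b + u *~ eps b.

Section Tv.
Variables (eps : A -> int) (u : A) (x : G).
Hypothesis epsD : is_add eps.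
Hypothesis epsu : eps u = 0.
Hypothesis xtv : tv eps u x.


Lemma tv_V b : act x^-1%g b = b - u *~ eps b.
Proof.
apply: (@act_inj _ _ _ _ M x); rewrite actVK xtv (add_mapB epsD) (add_mapMz epsD).
by rewrite epsu mul0rz subr0 subrK.
Qed.

Lemma tv_eV z : eact x^-1%g z = z - wedge u (iota eps z).
Proof.
have E := eact_is_add M x^-1%g; have I := @iota_is_add _ _ L eps.
elim/es_ind: z => [|z t hz ht|z hz|a b].
- by rewrite (add_map0 E) (add_map0 I) wedge0r subr0.
- by rewrite E I hz ht wedgeDr opprD addrACA.
- by rewrite (add_mapN E) (add_mapN I) hz wedgeNr opprD.
- rewrite eact_wedge !tv_V iota_wedge //; apply: es_coef_ext => i j.
  by rewrite !es_coefE /minor !fa_coefE; ring.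
Qed.

Lemma hom_comm_tv phi b : is_add phi -> hom_comm x phi b =
  (phi u - wedge u (iota eps (phi u))) *~ eps b - wedge u (iota eps (phi b)).
Proof.
move=> phiD; have E := eact_is_add M x^-1%g.
rewrite /hom_comm xtv phiD E (add_mapMz phiD) (add_mapMz E) !tv_eV.
by rewrite [LHS]addrC !addrA addNr add0r addrC.
Qed.

Lemma hom_comm_tv_axis phi : is_add phi -> hom_comm x phi u = - wedge u (iota eps (phi u)).
Proof. by move=> phiD; rewrite hom_comm_tv // epsu mulr0z sub0r. Qed.

Lemma wedge_iota_wedge b : wedge u (iota eps (wedge u b)) = 0.
Proof. by rewrite iota_wedge // epsu mulr0z sub0r wedgeNr wedgeMzr wedgexx mul0rz oppr0. Qed.

(** The operator [hom_comm x] is [P + Q + PQ] with commuting [P] and [Q] of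
    square zero, acting through [L] and through [A]; its square is [2PQ]. *)
Lemma hom_comm2_tv phi b : is_add phi ->
  hom_comm x (hom_comm x phi) b = wedge u (iota eps (phi u)) *~ -2 *~ eps b.
Proof.
move=> phiD; rewrite hom_comm_tv; last exact: is_add_hom_comm.
rewrite hom_comm_tv_axis // hom_comm_tv //; have I := @iota_is_add _ _ L eps.
rewrite (add_mapN I) wedgeNr wedge_iota_wedge oppr0 subr0 (add_mapB I).
rewrite (add_mapMz I) (add_mapB I) !(wedgeDr, wedgeNr, wedgeMzr) !wedge_iota_wedge.
by apply: es_coef_ext => i j; rewrite !es_coefE; ring.
Qed.

Lemma comm2_tv phi : is_add phi -> [~ ia phi, x, x]%g =
  ia (fun b => wedge u (iota eps (phi u)) *~ -2 *~ eps b).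
Proof.
move=> phiD; rewrite comm_ia // comm_ia; last exact: is_add_hom_comm.
by apply: ia_ext => b; rewrite hom_comm2_tv.
Qed.

Lemma comm3_tv (v : G) : triv v -> [~ v, x, x, x]%g = 1%g.
Proof.
move=> /act_trivial[phi phiD ->]; rewrite comm2_tv // comm_ia.
  rewrite -(ia0 M); apply: ia_ext => b.
  have I := @iota_is_add _ _ L eps.
  rewrite hom_comm_tv; last exact: is_add_rank1.
  rewrite epsu !mulr0z (add_map0 I) wedge0r subr0 mul0rz sub0r.
  by rewrite !(add_mapMz I) !wedgeMzr wedge_iota_wedge !mul0rz oppr0.
exact: is_add_rank1.
Qed.
End Tv.

Lemma transvection_tv eps u x : transvection eps u (act x) ->
  [/\ is_add eps, functional eps, u != 0, eps u = 0 & tv eps u x].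
Proof. by case=> epsD p u0 epsu xtv; split. Qed.

Lemma independent_in_kernel eps u : is_add eps -> u != 0 ->
  exists2 q, eps q = 0 & ~ parallel u q.
Proof.
move=> epsD /neq0_coef[i ui].
have [|q q0 [qe [qi _]]] := @common_kernel _ A _ nx_inj [:: eps; fa_coef i].
  by do !split=> //; exact: fa_coef_is_add.
exists q => // uq; have [j qj] := neq0_coef q0.
have /eqP := uq i j; rewrite qi mulr0 mulf_eq0; by rewrite (negPf ui) (negPf qj).
Qed.

Lemma rank1_eq1 eps z : is_add eps -> ia (fun b => z *~ eps b) = 1%g ->
  forall b, z *~ eps b = 0.
Proof.
move=> epsD h b; rewrite (rank1_inj nx_inj (M := M) (t := 0) epsD) ?mul0rz //.
by rewrite h -(ia0 M); apply: ia_ext => c; rewrite mul0rz.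
Qed.

(** The homomorphism [b |-> n b_i (p /\ w)] with [eps p = 1] has contraction
    [n u_i w] at [u]. *)
Lemma comm2_tv_wedge eps u w x i n : functional eps -> eps u = 0 -> eps w = 0 ->
  tv eps u x -> exists2 v : G, triv v &
  [~ v, x, x]%g = ia (fun b => wedge u w *~ (u@_i * n) *~ -2 *~ eps b).
Proof.
move=> [epsD [p p1]] epsu epsw xtv.
pose phi b := wedge p w *~ n *~ b@_i.
have phiD : is_add phi by apply: is_add_rank1; exact: fa_coef_is_add.
exists (ia phi); first exact: triv_ia.
rewrite (comm2_tv epsD epsu xtv phiD); apply: ia_ext => b; rewrite /phi.
rewrite !(add_mapMz (@iota_is_add _ _ L eps)) iota_wedge // p1 epsw mulr0z subr0.
rewrite mulr1z !wedgeMzr; apply: es_coef_ext => k l; rewrite !es_coefE; ring.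
Qed.

(** A vector [q] of the kernel of [eps] that is independent of [u] gives the
    double commutator [eps (x) (u /\ q)], up to a nonzero factor. *)
Lemma tv_comm2_neq1 eps u x : functional eps -> u != 0 -> eps u = 0 -> tv eps u x ->
  exists2 v : G, triv v & [~ v, x, x]%g <> 1%g.
Proof.
move=> epsF u0 epsu xtv; have [epsD [p p1]] := epsF.
have [q epsq uq] := independent_in_kernel epsD u0.
have [i ui] := neq0_coef u0.
have [v vt vE] := comm2_tv_wedge i 1 epsF epsu epsq xtv.
exists v => //; rewrite vE => /(rank1_eq1 epsD)/(_ p); rewrite p1 mulr1z.
have n2 : (-2 : int) != 0 by [].
move=> /(es_torsion_free n2)/es_torsion_free; rewrite mulr1 => /(_ ui).
by move/wedge_eq0.
Qed.

Lemma double_comm_triv x : (forall v : G, triv v -> [~ v, x, x]%g = 1%g) -> triv x.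
Proof.
move=> H; have [||[eps [u]]] := triple_comm_transvection (M := M) nx_inj (x := x) => //.
  by move=> v vt; apply: H; exact: triv_comm_x.
move=> /transvection_tv[epsD epsF u0 epsu xtv].
have [v vt] := tv_comm2_neq1 epsF u0 epsu xtv; by rewrite H.
Qed.

(** If [x] commutes with its conjugates, it commutes with [[v, x]], a product of
    [x] and of a conjugate of its inverse; so [[v, x, x] = 1]. *)
Lemma triv_self_comm x : triv x <-> forall y, commute x (x ^ y)%g.
Proof.
split=> [xt y|xc]; first by apply: triv_comm => //; exact: trivJ.
apply: double_comm_triv => v _; apply/eqP/commgP.
have -> : [~ v, x]%g = ((x ^ v)^-1 * x)%g.
  by rewrite -invgR commgEl invgM invgK.
apply: commute_sym; apply: commuteM => //; apply: commuteV; exact: xc.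
Qed.

(** V has no 2-torsion: if [2 phi] is inner by [a], the coordinates of
    [2 phi (e j)] show that [a] is even, and [phi] is inner by its half. *)
Lemma triv_sq_inj (v w : G) : triv v -> triv w -> (v * v = w * w)%g -> v = w.
Proof.
move=> vt wt vw; have wVt := trivV wt.
apply/eqP; rewrite -divg_eq1; apply/eqP.
have /act_trivial[phi phiD hphi] := trivM vt wVt; rewrite hphi.
have : (ia phi * ia phi = 1)%g.
  rewrite -hphi; rewrite -mulgA (mulgA w^-1%g) (triv_comm wVt vt) -!mulgA.
  by rewrite -invgM mulgA vw mulgV.
rewrite -iaD // => h2.
have [|a aP] := (ia_eq1 M _).1 h2; first exact: is_addD.
have [a' a'E] : exists a', a = a' *~ 2.
  have ev i : exists n : int, a@_i = n * 2.
    have [j ij] : exists j, j != i.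
      have [j] := fresh nx_inj [fset i]%fset; rewrite in_fset1; by exists j.
    exists (es_coef j i (phi (e j))); have := congr1 (es_coef j i) (aP (e j)).
    by rewrite !es_coefE /minor !fa_coef_basis eqxx (negPf ij) /=; lia.
  have [c cP] := choice ev; have [s sP] := finite_support a.
  have [i /sP ai|a' a'c] := @fa_realize _ A c s.
    by have := cP i; rewrite ai; lia.
  by exists a'; apply: fa_coef_ext => i; rewrite fa_coefMz a'c cP mulrC.
apply/(ia_eq1 M) => //; exists a' => b; apply/eqP; rewrite -subr_eq0; apply/eqP.
apply: (@es_torsion_free _ _ L _ 2) => //.
rewrite mulrzBl -wedgeMzr -a'E -aP; apply: es_coef_ext => i j; rewrite !es_coefE; ring.
Qed.

Lemma exists_minus : exists th, forall a, act th a = - a.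
Proof.
by apply: (@act_onto _ _ _ _ M _ (fun a => - a)) => [a b|a|a];
  rewrite ?opprK ?opprD.
Qed.

(** The action of [-1] on [L] is trivial. *)
Lemma minus_conj th (v : G) : (forall a, act th a = - a) -> triv v ->
  (v ^ th)%g = v^-1%g.
Proof.
move=> thE /act_trivial[phi phiD ->]; rewrite iaJ // -iaN //.
apply: ia_ext => b; rewrite thE (add_mapN phiD) (add_mapN (eact_is_add M _)).
congr (- _); have thV a : act th^-1%g a = - a.
  by apply: (@act_inj _ _ _ _ M th); rewrite actVK thE opprK.
elim/es_ind: (phi b) => [|z t hz ht|z hz|a c].
- by rewrite (add_map0 (eact_is_add M _)).
- by rewrite (eact_is_add M) hz ht.
- by rewrite (add_mapN (eact_is_add M _)) hz.
- by rewrite eact_wedge !thV wedgeNl wedgeNr opprK.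
Qed.

Lemma model_center x : (forall y, commute x y) -> x = 1%g.
Proof.
move=> xc; have xt : triv x by apply/triv_self_comm => y; apply: xc.
have [th thE] := exists_minus; have := minus_conj thE xt.
rewrite conjgE (xc th) mulKg => xV.
apply: triv_sq_inj => //; first exact: triv1.
by rewrite mulg1 {2}xV mulgV.
Qed.

(** Both double commutators are rank one homomorphisms, equal modulo inner ones
    and therefore equal; the common value determines the functional up to a
    factor. *)
Lemma comm2_fparallel eps u x del w y (v v' : G) :
  transvection eps u (act x) -> transvection del w (act y) ->
  triv v -> triv v' -> [~ v, x, x]%g = [~ v', y, y]%g -> [~ v, x, x]%g <> 1%g ->
  fparallel eps del.
Proof.
move=> /transvection_tv[epsD _ u0 epsu xtv] /transvection_tv[delD _ w0 delw ytv].
move=> /act_trivial[phi phiD ->] /act_trivial[psi psiD ->].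
rewrite (comm2_tv epsD epsu xtv phiD) (comm2_tv delD delw ytv psiD).
set z := _ *~ -2; set t := _ *~ -2 => zt zn1.
have [||a aP] := ia_inj _ _ zt; try exact: is_add_rank1.
have a0 : a = 0.
  apply: (finite_rank_inner nx_inj (s := [:: eps; del]) _ _ aP) => //.
  by move=> b [-> [-> _]]; rewrite !mulr0z subrr.
have /neq0_es_coef[i [j zij]] : z != 0.
  apply/eqP => z0; apply: zn1; rewrite -(ia0 M) z0; apply: ia_ext => b.
  by rewrite mul0rz.
have h b : es_coef i j z * eps b = es_coef i j t * del b.
  have := congr1 (es_coef i j) (aP b); rewrite a0 wedge0r !es_coefE => hb.
  by apply/eqP; rewrite -subr_eq0; apply/eqP; rewrite -[RHS]hb; ring.
move=> b c; apply: (mulfI zij).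
by rewrite !mulrA !h -!mulrA; congr (_ * _); rewrite mulrC.
Qed.

(** The common value is a multiple of [eps (x) (u /\ w)]. *)
Lemma comm2_common eps u x w y : functional eps -> eps u = 0 -> eps w = 0 ->
  tv eps u x -> tv eps w y -> ~ parallel u w ->
  exists v v' : G, [/\ triv v, triv v', [~ v, x, x]%g = [~ v', y, y]%g
    & [~ v, x, x]%g <> 1%g].
Proof.
move=> epsF epsu epsw xtv ytv uw; have [epsD [p p1]] := epsF.
have [i [j ij]] := non_parallelP uw.
have [i' ui] : exists i, u@_i != 0.
  by apply: neq0_coef; apply/eqP => u0; move: ij; rewrite u0 !fa_coef0 !mul0r eqxx.
have [k wk] : exists k, w@_k != 0.
  by apply: neq0_coef; apply/eqP => w0; move: ij; rewrite w0 !fa_coef0 !mulr0 eqxx.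
(* The factors are exchanged so that the two multiples of [u /\ w] agree. *)
have [v vt vE] := comm2_tv_wedge i' (- w@_k) epsF epsu epsw xtv.
have [v' v't v'E] := comm2_tv_wedge k u@_i' epsF epsw epsu ytv.
exists v, v'; split=> //; rewrite vE ?v'E.
  apply: ia_ext => b; rewrite (wedgeC L w); apply: es_coef_ext => q r; rewrite !es_coefE; ring.
move/(rank1_eq1 epsD)/(_ p); rewrite p1 mulr1z.
have n2 : (-2 : int) != 0 by [].
move=> /(es_torsion_free n2)/es_torsion_free.
by rewrite mulrN oppr_eq0 mulf_neq0 // => /(_ isT)/wedge_eq0.
Qed.

End Transvections.

(** * Images of transvections under an automorphism *)
Section ImagesOfTransvections.
Variables (X : choiceType) (A : freeAbelian X) (L : exteriorSquare A).
Variables (G : groupType) (M : linearModel L G).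
Variable nx : nat -> X.
Hypothesis nx_inj : injective nx.
Local Notation "a @_ i" := (fa_coef i a).
Local Notation e := (basis A).
Local Notation wedge := (wedge L).
Local Notation act := (act M).
Local Notation eact := (eact M).
Local Notation ia := (ia M).
Local Notation hom_comm := (hom_comm M).
Local Notation triv := (triv M).
Local Notation tv := (tv M).
Implicit Types (a b u v w : A) (i j k : X) (z t : L) (x y : G) (phi psi : A -> L).
Implicit Types (eps del : A -> int) (al : aut G).



Lemma tv_lift eps u : is_add eps -> eps u = 0 -> exists x, tv eps u x.
Proof.
move=> epsD epsu; apply: (@act_onto _ _ _ _ M _ (fun b => b - u *~ eps b)).
- by move=> a b; rewrite epsD mulrzDr addrACA.
- by move=> a /=; rewrite epsD (add_mapMz epsD) epsu mul0rz addr0 addrK.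
- by move=> a /=; rewrite (add_mapB epsD) (add_mapMz epsD) epsu mul0rz subr0 subrK.
Qed.

Section Automorphism.
Variable al : aut G.

Lemma aut_inj : injective al. Proof. exact: can_inj (aut_funK al). Qed.

Lemma aut_triv x : triv (al x) <-> triv x.
Proof.
rewrite !(triv_self_comm M nx_inj); split=> xc y; last first.
  by rewrite -(aut_inv_funK al y) -gmulfJ; apply: gmulf_commute.
have := xc (al y); rewrite -gmulfJ /commute => h.
by apply: aut_inj; rewrite (aut_morph al x) (aut_morph al (x ^ y)%g).
Qed.

Lemma aut_act x y : (forall a, act x a = act y a) ->
  forall a, act (al x) a = act (al y) a.
Proof.
move=> xy; have : triv (y^-1 * x)%g by move=> a; rewrite actM xy actK.
move/aut_triv; rewrite gmulfM gmulfV => h a.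
by rewrite -[in RHS](h a) actM actVK.
Qed.

Lemma aut_transvection eps u x : transvection eps u (act x) ->
  exists eps' u', transvection eps' u' (act (al x)).
Proof.
move=> xT; have [epsD epsF u0 epsu xtv] := transvection_tv xT.
have [||//] := triple_comm_transvection (M := M) nx_inj (x := al x).
  move=> v; rewrite -(aut_inv_funK al v) => /aut_triv vt.
  by rewrite -!gmulfR (comm3_tv epsD epsu xtv vt) gmulf1.
move=> /aut_triv xt; have [_ [p p1]] := epsF.
case/eqP: u0; apply: (addrI p); have := xt p.
by rewrite xtv p1 mulr1z addr0.
Qed.

Lemma transvection_of_tv eps u x : functional eps -> u != 0 -> eps u = 0 ->
  tv eps u x -> transvection eps u (act x).
Proof. by move=> [epsD p] u0 epsu xtv; split. Qed.

Definition equal_or_opposite eps del :=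
  (forall a, del a = eps a) \/ (forall a, del a = - eps a).

(** Images of transvections with independent directions have a common double
    commutator. Parallel directions are compared through a third one. *)
Lemma image_functional eps u w x y eps1 u1 eps2 u2 :
  functional eps -> u != 0 -> w != 0 -> eps u = 0 -> eps w = 0 ->
  tv eps u x -> tv eps w y ->
  transvection eps1 u1 (act (al x)) -> transvection eps2 u2 (act (al y)) ->
  equal_or_opposite eps1 eps2.
Proof.
move=> epsF u0 w0 epsu epsw xtv ytv xT yT.
have indep (v1 v2 : A) (z1 z2 : G) d1 d2 s1 s2 : ~ parallel v1 v2 ->
    eps v1 = 0 -> eps v2 = 0 -> tv eps v1 z1 -> tv eps v2 z2 ->
    transvection d1 s1 (act (al z1)) -> transvection d2 s2 (act (al z2)) ->
    equal_or_opposite d1 d2.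
  move=> v12 epsv1 epsv2 z1tv z2tv z1T z2T.
  have [v [v' [vt v't vE vn1]]] := comm2_common nx_inj epsF epsv1 epsv2 z1tv z2tv v12.
  have [_ [_ [p p1]] _ _ _] := transvection_tv z1T.
  have [_ [_ [q q1]] _ _ _] := transvection_tv z2T.
  apply: (fparallel_surj _ p1 q1).
  apply: (comm2_fparallel nx_inj z1T z2T (v := al v) (v' := al v')); rewrite ?aut_triv //.
    by rewrite -!gmulfR vE.
  by rewrite -!gmulfR -(aut_fun1 al) => /aut_inj.
have [uw|] := pselect (parallel u w); last by move=> h; apply: indep h _ _ xtv ytv xT yT.
have [q epsq uq] := independent_in_kernel nx_inj (proj1 epsF) u0.
have q0 : q != 0 by apply/eqP => q0; apply: uq => i j; rewrite q0 !fa_coef0 !mulr0.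
have qw : ~ parallel q w.
  by move=> qw; apply: uq; apply: parallel_trans w0 uw _ => i j; have := qw i j; lia.
have [z ztv] := tv_lift (proj1 epsF) epsq.
have [eps3 [u3 zT]] := aut_transvection (transvection_of_tv epsF q0 epsq ztv).
have h1 := indep _ _ _ _ _ _ _ _ uq epsu epsq xtv ztv xT zT.
have h2 := indep _ _ _ _ _ _ _ _ qw epsq epsw ztv ytv zT yT.
by case: h1 => h1; case: h2 => h2; [left|right|right|left] => a; rewrite h2 h1 ?opprK.
Qed.

End Automorphism.


Lemma tv_unique eps u w x y : functional eps -> tv eps u x -> tv eps w y ->
  (forall a, act x a = act y a) -> u = w.
Proof.
move=> [_ [p p1]] xtv ytv xy; apply: (addrI p); have := xy p.
by rewrite xtv ytv p1.
Qed.

Lemma tvM eps u w x y : is_add eps -> eps w = 0 -> tv eps u x -> tv eps w y ->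
  tv eps (u + w) (x * y)%g.
Proof.
move=> epsD epsw xtv ytv b; rewrite actM xtv ytv epsD (add_mapMz epsD) epsw.
by rewrite mul0rz addr0 mulrzDl -addrA; congr (_ + _); rewrite addrC.
Qed.

Lemma tv_eq eps del u x : (forall a, del a = eps a) -> tv eps u x -> tv del u x.
Proof. by move=> ed xtv b; rewrite xtv ed. Qed.

Lemma tv_opp eps del u x : (forall a, del a = - eps a) -> tv eps u x -> tv del (- u) x.
Proof. by move=> ed xtv b; rewrite xtv ed mulrNz mulNrz opprK. Qed.

Lemma tv_opposite eps del u x : equal_or_opposite eps del -> tv del u x ->
  tv eps u x \/ tv eps (- u) x.
Proof.
by case=> ed xtv; [left; apply: tv_eq xtv | right; apply: tv_opp xtv] => a;
  rewrite ed ?opprK.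
Qed.

Lemma tv_triv eps u x : u = 0 -> tv eps u x -> triv x.
Proof. by move=> -> xtv b; rewrite xtv mul0rz addr0. Qed.

(** The transvections with functional [eps] form a group isomorphic to the kernel
    of [eps], and by [image_functional] their images share one functional. The
    map [a] is extended to [A] by zero on a complement of the kernel;
    surjectivity is the same statement for the inverse automorphism. *)
Lemma aut_kernel al eps : functional eps -> exists (eps' : A -> int) (a : A -> A),
  [/\ functional eps', is_add a,
      forall u, eps u = 0 -> eps' (a u) = 0 /\
        forall x, tv eps u x -> tv eps' (a u) (al x) &
      forall w, eps' w = 0 -> exists2 u, eps u = 0 & a u = w].
Proof.
move=> epsF; have [epsD [p p1]] := epsF.
have [|u1 u10 [epsu1 _]] := @common_kernel _ A _ nx_inj [:: eps]; first by split.
have [x1 x1tv] := tv_lift epsD epsu1.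
have [eps' [u1' x1T]] := aut_transvection al (transvection_of_tv epsF u10 epsu1 x1tv).
have [_ eps'F u1'0 eps'u1' x1tv'] := transvection_tv x1T.
have [eps'D [p' p'1]] := eps'F.
have H u : exists u', eps u = 0 -> eps' u' = 0 /\
    forall x, tv eps u x -> tv eps' u' (al x).
  have [epsu|] := pselect (eps u = 0); last by exists 0.
  have [x xtv] := tv_lift epsD epsu.
  suff [u' [eps'u' xtv']] : exists u', eps' u' = 0 /\ tv eps' u' (al x).
    exists u' => _; split=> // y ytv b; rewrite -xtv'; apply: aut_act => c.
    by rewrite xtv ytv.
  have [u0|u0] := eqVneq u 0.
    exists 0; split; first exact: (add_map0 eps'D).
    by move=> b; rewrite mul0rz addr0; move: b; apply/aut_triv/(tv_triv u0 xtv).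
  have [del [u' xT]] := aut_transvection al (transvection_of_tv epsF u0 epsu xtv).
  have [delD _ _ delu' xtv'] := transvection_tv xT.
  have oe := image_functional epsF u10 u0 epsu1 epsu x1tv xtv x1T xT.
  have eps'u' : eps' u' = 0 by case: oe => oe; have := oe u'; rewrite delu'; lia.
  have [h|h] := tv_opposite oe xtv'; [exists u' | exists (- u')]; split=> //.
  by rewrite (add_mapN eps'D) eps'u' oppr0.
have [a aP] := choice H.
have aD u w : eps u = 0 -> eps w = 0 -> a (u + w) = a u + a w.
  move=> epsu epsw; have [x xtv] := tv_lift epsD epsu.
  have [y ytv] := tv_lift epsD epsw.
  have [_ /(_ _ xtv) xtv'] := aP _ epsu; have [eps'w /(_ _ ytv) ytv'] := aP _ epsw.
  have epsuw : eps (u + w) = 0 by rewrite epsD epsu epsw.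
  have [_ /(_ _ (tvM epsD epsw xtv ytv)) xytv'] := aP _ epsuw.
  apply: (tv_unique eps'F xytv' (tvM eps'D eps'w xtv' ytv')) => b.
  by rewrite aut_morph.
pose k b := b - p *~ eps b.
have kD : is_add k by move=> b c; rewrite /k epsD mulrzDr opprD addrACA.
have epsk b : eps (k b) = 0.
  by rewrite /k (add_mapB epsD) (add_mapMz epsD) p1 mulrzz mul1r subrr.
have kid u : eps u = 0 -> k u = u by rewrite /k => ->; rewrite mulr0z subr0.
exists eps', (a \o k); split=> //.
- by move=> b c /=; rewrite kD aD.
- by move=> u epsu; rewrite /= kid //; exact: aP.
move=> w eps'w; have [y ytv] := tv_lift eps'D eps'w.
suff [u epsu xtv] : exists2 u, eps u = 0 & tv eps u (aut_inv_fun al y).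
  exists u => //=; rewrite kid //; have [_ /(_ _ xtv)] := aP _ epsu.
  by rewrite aut_inv_funK => h; apply: (tv_unique eps'F h ytv).
have [w0|w0] := eqVneq w 0.
  exists 0; first exact: (add_map0 epsD).
  move=> b; rewrite mul0rz addr0; move: b; apply/(aut_triv al).
  by rewrite aut_inv_funK; apply: tv_triv w0 ytv.
have yT := transvection_of_tv eps'F w0 eps'w ytv.
have [del [u xT]] := aut_transvection (aut_inv al) yT.
have [delD _ _ delu xtv'] := transvection_tv xT.
have x1T' : transvection eps u1 (act (aut_inv al (al x1))).
  by rewrite /= aut_funK; apply: transvection_of_tv.
have oe := image_functional eps'F u1'0 w0 eps'u1' eps'w x1tv' ytv x1T' xT.
have epsu : eps u = 0 by case: oe => oe; have := oe u; rewrite delu; lia.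
have [h|h] := tv_opposite oe xtv'; [exists u | exists (- u)] => //.
by rewrite (add_mapN epsD) epsu oppr0.
Qed.

Lemma conj_aut_morph y : {morph (fun x => x ^ y)%g : x1 x2 / (x1 * x2)%g}.
Proof. by move=> x1 x2; rewrite conjMg. Qed.
Lemma conj_aut_bij y : bijective (fun x => x ^ y)%g.
Proof. by exists (fun x => x ^ y^-1)%g => x; rewrite (conjgK, conjgKV). Qed.
Definition conj_aut y : aut G := Automorphism (@conj_aut_morph y) (conj_aut_bij y).

Lemma inner_conj_aut al y : is_inner (aut_mul (conj_aut y) al) -> is_inner al.
Proof.
move=> [z alz]; exists (z * y^-1)%g => x.
by rewrite conjgM -alz /= conjgK.
Qed.

Lemma act_conj eps w x y : tv eps w x -> forall b,
  act (x ^ y)%g b = b + act y^-1%g w *~ eps (act y b).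
Proof.
move=> xtv b; rewrite !actM xtv (act_is_add M) (add_mapMz (act_is_add M _)).
by rewrite actK.
Qed.

Lemma act_onto_bij (h : A -> A) : is_add h -> (forall b, h b = 0 -> b = 0) ->
  (forall c, exists b, h b = c) -> exists x, forall a, act x a = h a.
Proof.
move=> hD h0 hs; have [g gP] := choice hs.
apply: (act_onto M (h := g)) => // b; apply: (add_map_inj hD h0).
by rewrite gP.
Qed.

(** The isomorphism of kernels given by [aut_kernel], extended by sending a
    vector where [eps] is 1 to one where [eps'] is 1, is an automorphism of [A],
    and conjugation by an element inducing it undoes the effect of [al]. *)
Lemma straighten al eps : functional eps -> exists y, forall u x, eps u = 0 ->
  tv eps u x -> tv eps u (al x ^ y)%g.
Proof.
move=> epsF; have [epsD [p p1]] := epsF.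
have [eps' [a [eps'F aD aP asurj]]] := aut_kernel al epsF.
have [eps'D [p' p'1]] := eps'F.
pose k b := b - p *~ eps b.
have kD : is_add k by move=> b c; rewrite /k epsD mulrzDr opprD addrACA.
have epsk b : eps (k b) = 0.
  by rewrite /k (add_mapB epsD) (add_mapMz epsD) p1 mulrzz mul1r subrr.
have kid u : eps u = 0 -> k u = u by rewrite /k => ->; rewrite mulr0z subr0.
pose h b := a (k b) + p' *~ eps b.
have hD : is_add h by move=> b c; rewrite /h kD aD epsD mulrzDr addrACA.
have eps'h b : eps' (h b) = eps b.
  rewrite /h eps'D (add_mapMz eps'D) p'1 mulrzz mul1r.
  by have [-> _] := aP _ (epsk b); rewrite add0r.
have ainj u : eps u = 0 -> a u = 0 -> u = 0.
  move=> epsu au; have [x xtv] := tv_lift epsD epsu.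
  have [_ /(_ _ xtv)] := aP _ epsu; rewrite au => /(tv_triv erefl)/aut_triv xt.
  by apply: (addrI p); have := xt p; rewrite xtv p1 mulr1z addr0.
have hu u : eps u = 0 -> h u = a u.
  by move=> epsu; rewrite /h kid // epsu mulr0z addr0.
have [||y yh] := act_onto_bij hD.
- move=> b hb; have epsb : eps b = 0 by rewrite -eps'h hb (add_map0 eps'D).
  by apply: ainj => //; rewrite -hu.
- move=> c; have [|u epsu au] := asurj (c - p' *~ eps' c).
    by rewrite (add_mapB eps'D) (add_mapMz eps'D) p'1 mulrzz mul1r subrr.
  exists (u + p *~ eps' c); rewrite hD hu // au.
  rewrite /h /k (add_mapMz epsD) p1 mulrzz mul1r subrr (add_map0 aD) add0r.
  by rewrite subrK.
exists y => u x epsu xtv b; have [_ /(_ _ xtv) xtv'] := aP _ epsu.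
rewrite (act_conj y xtv') yh eps'h; congr (_ + _ *~ _).
by rewrite -hu // -yh actK.
Qed.

(** Suppose that [al] sends the transvections with functional [eps] to their
    [c]-th powers, and that [x] preserves [eps]. Conjugating these transvections by [x] and
    by [al x] shows that the two induce the same map on the kernel of [eps]. *)
Lemma fixed_kernel al eps (c : int) del w del' w' x :
  functional eps -> c != 0 ->
  (forall u (z : G), eps u = 0 -> tv eps u z -> tv eps (u *~ c) (al z)) ->
  is_add del -> del w = 0 -> eps w = 0 -> tv del w x ->
  functional del' -> del' w' = 0 -> tv del' w' (al x) ->
  eps w' = 0 /\ forall v, eps v = 0 -> w' *~ del' v = w *~ del v.
Proof.
move=> [epsD [p p1]] c0 fix_eps delD delw epsw xtv [del'D [p' p'1]] del'w' xtv'.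
have key v b : eps v = 0 ->
    (v - w' *~ del' v) *~ (eps b + eps w' * del' b) = (v - w *~ del v) *~ eps b.
  move=> epsv; have [z ztv] := tv_lift epsD epsv.
  have zxtv : tv eps (v - w *~ del v) (z ^ x)%g.
    move=> d; rewrite (act_conj x ztv) (tv_V delD delw xtv).
    by rewrite xtv epsD (add_mapMz epsD) epsw mul0rz addr0.
  have epsv1 : eps (v - w *~ del v) = 0.
    by rewrite (add_mapB epsD) (add_mapMz epsD) epsw mul0rz epsv subr0.
  have := fix_eps _ _ epsv1 zxtv b.
  rewrite gmulfJ (act_conj _ (fix_eps _ _ epsv ztv)) (tv_V del'D del'w' xtv').
  move=> /addrI; rewrite (add_mapMz del'D) xtv' epsD (add_mapMz epsD) !mulrzz => h.
  apply: fa_coef_ext => i; apply: (mulfI c0).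
  have := congr1 (fa_coef i) h; rewrite !fa_coefE => hi.
  transitivity ((eps b + eps w' * del' b) * (c * v@_i - del' v * c * w'@_i)).
    by ring.
  by rewrite hi; ring.
have epsw' : eps w' = 0.
  (* On a vector killed by all three functionals only the factor of [eps] can
     differ. *)
  have [|v v0 [epsv [delv [del'v _]]]] := @common_kernel _ A _ nx_inj [:: eps; del; del'].
    by do !split.
  have [i vi] := neq0_coef v0; have := congr1 (fa_coef i) (key v p' epsv).
  rewrite delv del'v !mulr0z subr0 !fa_coefMz p'1 mulr1 => /(mulIf vi); lia.
split=> // v epsv; have := key v p epsv.
by rewrite epsw' mul0r addr0 p1 !mulr1z => /addrI/oppr_inj.
Qed.

End ImagesOfTransvections.

(** * Straightening an automorphism *)
Section Straightening.
Variables (X : choiceType) (A : freeAbelian X) (L : exteriorSquare A).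
Variables (G : groupType) (M : linearModel L G).
Variable nx : nat -> X.
Hypothesis nx_inj : injective nx.
Local Notation "a @_ i" := (fa_coef i a).
Local Notation e := (basis A).
Local Notation wedge := (wedge L).
Local Notation act := (act M).
Local Notation eact := (eact M).
Local Notation ia := (ia M).
Local Notation hom_comm := (hom_comm M).
Local Notation triv := (triv M).
Local Notation tv := (tv M).
Local Notation conj_aut := (@conj_aut G).
Implicit Types (a b u v w : A) (i j k : X) (z t : L) (x y : G) (phi psi : A -> L).
Implicit Types (eps del : A -> int) (al : aut G).




Let i0 := nx 0.
Let i1 := nx 1.
Let i2 := nx 2.
Let eps0 : A -> int := fa_coef i0.
Let eps1 : A -> int := fa_coef i1.

Let i01 : (i0 == i1) = false. Proof. by rewrite (inj_eq nx_inj). Qed.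
Let i10 : (i1 == i0) = false. Proof. by rewrite (inj_eq nx_inj). Qed.
Let i20 : (i2 == i0) = false. Proof. by rewrite (inj_eq nx_inj). Qed.
Let i21 : (i2 == i1) = false. Proof. by rewrite (inj_eq nx_inj). Qed.
Let eps0F : functional eps0 := functional_coef A i0.
Let eps1F : functional eps1 := functional_coef A i1.
Let eps0D : is_add eps0 := fa_coef_is_add (f := A) i0.
Let eps1D : is_add eps1 := fa_coef_is_add (f := A) i1.

(** [al] maps the transvections with functional [eps] to their [c]-th powers. *)
Let fixes al (c : int) eps := forall u (z : G), eps u = 0 -> tv eps u z ->
  tv eps (u *~ c) (al z).

(** By [fixed_kernel] the map [a] of the second kernel is a sign [m] on the
    intersection of the two kernels. What is left is the image of [e i0], and it
    is corrected by an automorphism that is the identity on the first kernel. *)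
Let straighten_two al : fixes al 1 eps0 -> exists (c : int) y, c != 0 /\
  (fixes (aut_mul (conj_aut y) al) c eps0 /\ fixes (aut_mul (conj_aut y) al) 1 eps1).
Proof.
move=> fix0; have [eps1' [a [eps1'F aD aP asurj]]] := aut_kernel M nx_inj al eps1F.
have [eps1'D _] := eps1'F.
have onK u : eps0 u = 0 -> eps1 u = 0 -> eps0 (a u) = 0 /\
    forall v, eps0 v = 0 -> a u *~ eps1' v = u *~ eps1 v.
  move=> u0 u1; have [x xtv] := tv_lift M eps1D u1.
  have [eps1'au /(_ _ xtv) xtv'] := aP _ u1.
  exact: (fixed_kernel nx_inj eps0F (c := 1) _ fix0 eps1D u1 u0 xtv eps1'F eps1'au xtv').
pose m := eps1' (e i1).
have [_ he2] : eps0 (a (e i2)) = 0 /\ forall v, eps0 v = 0 ->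
    a (e i2) *~ eps1' v = e i2 *~ eps1 v.
  by apply: onK; rewrite /eps0 /eps1 fa_coef_basis ?i20 ?i21.
have e1K : eps0 (e i1) = 0 by rewrite /eps0 fa_coef_basis i10.
have m2 : m * m = 1.
  have := congr1 (fa_coef i2) (he2 (e i1) e1K).
  rewrite /eps1 !fa_coefE !eqxx /= -/m mul1r => h.
  have : `|m|%N = 1%N.
    have : (`|m| * `|(a (e i2))@_i2|)%N = 1%N by rewrite -abszM h.
    by move/eqP; rewrite muln_eq1 => /andP[/eqP].
  by move=> ?; have [->|->] : m = 1 \/ m = -1 by lia.
have aK u : eps0 u = 0 -> eps1 u = 0 -> a u = u *~ m.
  move=> u0 u1; have [_ /(_ _ e1K)] := onK u u0 u1.
  rewrite /eps1 fa_coef_basis eqxx mulr1z -/m => hu.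
  by rewrite -[in RHS]hu -mulrzA m2 mulr1z.
have eps1'K v : eps0 v = 0 -> eps1' v = m * eps1 v.
  move=> v0; have := congr1 (fa_coef i2) (he2 v v0).
  rewrite aK ?fa_coefE /eps0 /eps1 ?fa_coef_basis ?i20 ?i21 // eqxx /= mulr1 => h.
  by rewrite -[LHS]mul1r -m2 -mulrA (mulrC m (eps1' v)) h mulr1.
pose q := a (e i0) *~ m; pose c := eps0 q.
have e0K1 : eps1 (e i0) = 0 by rewrite /eps1 fa_coef_basis i01.
have e00 : eps0 (e i0) = 1 by rewrite /eps0 fa_coef_basis eqxx.
have eps1'q : eps1' q = 0.
  by rewrite /q (add_mapMz eps1'D) (aP _ e0K1).1 mul0rz.
(* The vector [e i0 - m eps1'(e i0) e i1] lies in the image of the second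
   kernel, and its first coordinate is 1, which makes [c] invertible. *)
have c2 : c * c = 1.
  have [|v v1 av] := asurj (e i0 - e i1 *~ (m * eps1' (e i0))).
    rewrite (add_mapB eps1'D) (add_mapMz eps1'D) -/m mulrzz mulrA m2 mul1r.
    by rewrite subrr.
  have := congr1 eps0 av; rewrite (add_mapB eps0D) (add_mapMz eps0D) e00 e1K.
  rewrite mul0rz subr0.
  have -> : v = (v - e i0 *~ eps0 v) + e i0 *~ eps0 v by rewrite subrK.
  have v0K : eps0 (v - e i0 *~ eps0 v) = 0.
    by rewrite (add_mapB eps0D) (add_mapMz eps0D) e00 mulrzz mul1r subrr.
  have v1K : eps1 (v - e i0 *~ eps0 v) = 0.
    by rewrite (add_mapB eps1D) (add_mapMz eps1D) e0K1 v1 mul0rz subrr.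
  rewrite aD aK // (add_mapMz aD) eps0D !(add_mapMz eps0D) v0K mul0rz add0r => h.
  have : `|c|%N = 1%N.
    rewrite /c /q (add_mapMz eps0D) mulrzz abszM.
    have : (`|eps0 (a (e i0))| * `|eps0 v|)%N = 1%N by rewrite -abszM -mulrzz h.
    move/eqP; rewrite muln_eq1 => /andP[/eqP -> _].
    by have := congr1 absz m2; rewrite abszM mul1n => /eqP; rewrite muln_eq1 => /andP[/eqP].
  by move=> ?; have [->|->] : c = 1 \/ c = -1 by lia.
pose h b := b + (q - e i0) *~ eps0 b.
have hD : is_add h by move=> b d; rewrite /h eps0D mulrzDr addrACA.
have eps0h b : eps0 (h b) = c * eps0 b.
  rewrite /h eps0D (add_mapMz eps0D) (add_mapB eps0D) e00 -/c mulrzz; ring.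
have [||y yh] := @act_onto _ _ _ _ M h (fun b => b - (q - e i0) *~ (c * eps0 b)) hD.
- move=> b /=; rewrite eps0h mulrA c2 mul1r; exact: addrK.
- move=> b /=; rewrite /h (add_mapB eps0D) (add_mapMz eps0D) (add_mapB eps0D) e00 -/c.
  rewrite mulrzz.
  have -> : eps0 b - (c - 1) * (c * eps0 b) = c * eps0 b.
    rewrite -[in LHS](mul1r (eps0 b)) -{1}c2; ring.
  by rewrite subrK.
have hK u : eps0 u = 0 -> h u = u by rewrite /h => ->; rewrite mulr0z addr0.
have yVK u : act y^-1%g (h u) = u by rewrite -yh actK.
have eps1'h b : eps1' (h b) = m * eps1 b.
  have -> : h b = (b - e i0 *~ eps0 b) + q *~ eps0 b.
    by rewrite /h mulrzBl addrA addrAC.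
  have bK : eps0 (b - e i0 *~ eps0 b) = 0.
    by rewrite (add_mapB eps0D) (add_mapMz eps0D) e00 mulrzz mul1r subrr.
  rewrite eps1'D (add_mapMz eps1'D) eps1'q mul0rz addr0 eps1'K //.
  by rewrite (add_mapB eps1D) (add_mapMz eps1D) e0K1 mul0rz subr0.
exists c, y; split; first by apply/eqP => c0; move: c2; rewrite c0.
split=> u z epsu ztv b.
  rewrite /= (act_conj y (fix0 _ _ epsu ztv)) yh eps0h mulr1z.
  by rewrite -{1}(hK u epsu) yVK mulrzA.
have [_ /(_ _ ztv) ztv'] := aP _ epsu.
rewrite /= (act_conj y ztv') yh eps1'h.
have -> : a u = h (u *~ m).
  have -> : u = (u - e i0 *~ eps0 u) + e i0 *~ eps0 u by rewrite subrK.
  set u0 := u - _.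
  have u0K : eps0 u0 = 0.
    by rewrite (add_mapB eps0D) (add_mapMz eps0D) e00 mulrzz mul1r subrr.
  have u0K1 : eps1 u0 = 0.
    by rewrite (add_mapB eps1D) (add_mapMz eps1D) e0K1 epsu mul0rz subrr.
  rewrite aD aK // (add_mapMz hD) hD (hK u0) // (add_mapMz hD) (add_mapMz aD).
  rewrite mulrzDl; congr (_ + _).
  rewrite /h e00 mulr1z addrC subrK /q -!mulrzA; congr (_ *~ _).
  by rewrite -[LHS]mulr1 -m2; ring.
by rewrite yVK mulr1z -mulrzA mulrA m2 mul1r.
Qed.

Section Fixed.
Variables (al : aut G) (c : int).
Hypothesis c0 : c != 0.
Hypothesis fix0 : fixes al c eps0.
Hypothesis fix1 : fixes al 1 eps1.

(** For [w] in both kernels, [x] preserves both functionals, so [al x] and [x]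
    agree on each kernel, and the two kernels span [A]. *)
Let fix_small del w x : functional del -> del w = 0 -> eps0 w = 0 -> eps1 w = 0 ->
  tv del w x -> forall a, act (al x) a = act x a.
Proof.
move=> delF delw w0 w1 xtv.
have [w00|wn0] := eqVneq w 0.
  have xt := tv_triv w00 xtv; have xt' := (aut_triv M nx_inj al x).2 xt.
  by move=> a; rewrite xt xt'.
have xT := transvection_of_tv delF wn0 delw xtv.
have [del' [w' xT']] := aut_transvection nx_inj al xT.
have [del'D del'F _ del'w' xtv'] := transvection_tv xT'.
have delD := proj1 delF.
have [_ h0] := fixed_kernel nx_inj eps0F c0 fix0 delD delw w0 xtv del'F del'w' xtv'.
have [_ h1] := fixed_kernel nx_inj (c := 1) eps1F isT fix1 delD delw w1 xtv del'F del'w' xtv'.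
move=> a; rewrite xtv' xtv; congr (_ + _).
have -> : a = (a - e i0 *~ eps0 a) + e i0 *~ eps0 a by rewrite subrK.
rewrite del'D delD !mulrzDr h0 ?h1 //.
  rewrite (add_mapMz eps1D) /eps1 fa_coef_basis i01; exact: mul0rz.
by rewrite (add_mapB eps0D) (add_mapMz eps0D) /eps0 fa_coef_basis eqxx mulrzz mul1r subrr.
Qed.

(** Every functional [del] occurs in a transvection [x] such that [x] and its
    conjugate by [g] are both fixed by [fix_small]. Comparing the conjugates by
    [g] and by [al g] shows that [al g] and [g] move [del] in the same way, up
    to sign. *)
Lemma act_aut_sign g : (forall b, act (al g) b = act g b) \/
  (forall b, act (al g) b = - act g b).
Proof.
pose k b := act (al g) (act g^-1%g b).
have kD : is_add k by move=> b d; rewrite /k !(act_is_add M).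
have kdel del : functional del -> equal_or_opposite del (del \o k).
  move=> delF; have [delD [p p1]] := delF.
  have gD := act_is_add M g.
  have [|w wn0 [w0 [w1 [gw0 [gw1 [delgw _]]]]]] := @common_kernel _ A _ nx_inj
      [:: eps0; eps1; eps0 \o act g; eps1 \o act g; del \o act g].
    by do !split=> //; apply: is_add_comp.
  have [x xtv] := tv_lift M delD delgw.
  have xgtv : tv (del \o act g) w (x ^ g)%g.
    by move=> b; rewrite (act_conj g xtv) actK.
  have delgF : functional (del \o act g).
    split; first exact: is_add_comp.
    by exists (act g^-1%g p); rewrite /= actVK.
  have xfix := fix_small delF delgw gw0 gw1 xtv.
  have xgfix := fix_small delgF delgw w0 w1 xgtv.
  have xtv' : tv del (act g w) (al x) by move=> b; rewrite xfix xtv.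
  have h b : w *~ del (act g b) = act (al g)^-1%g (act g w) *~ del (act (al g) b).
    have := xgfix b; rewrite gmulfJ (act_conj _ xtv') xgtv => /addrI /=.
    by move=> <-.
  have [i wi] := neq0_coef wn0.
  have hp : fparallel del (del \o k).
    move=> b d; apply: (mulfI wi).
    have hb := congr1 (fa_coef i) (h (act g^-1%g b)).
    have hd := congr1 (fa_coef i) (h (act g^-1%g d)).
    move: hb hd; rewrite !fa_coefMz !actVK -!/(k _) /= => hb hd.
    transitivity ((del b * w@_i) * del (k d)); first by ring.
    rewrite hb.
    transitivity ((del (k d) * (act (al g)^-1%g (act g w))@_i) * del (k b)); first by ring.
    by rewrite -hd; ring.
  apply: (fparallel_surj hp p1 (q := act g (act (al g)^-1%g p))).
  by rewrite /= /k actK actVK.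
have kp b : parallel b (k b).
  apply: contrapT => /indep_separate[eps [epsD epsb epskb]].
  have [del [d [p [delD d0 p1 epsE]]]] := primitive_functional epsD epskb.
  have delF : functional del by split; last exists p.
  have delb : del b = 0 by apply: (mulfI d0); rewrite mulr0 -epsE.
  move: epskb; rewrite epsE.
  by case: (kdel _ delF) => h; have /= -> := h b; rewrite delb ?oppr0 mulr0 eqxx.
have [|n kn] := parallel_scalar kD.
  by move=> b i j; have := kp b j i; lia.
have E b : act (al g) b = act g b *~ n by rewrite -kn /k actK.
have e00 : eps0 (e i0) = 1 by rewrite /eps0 fa_coef_basis eqxx.
have nE : eps0 (k (e i0)) = n by rewrite kn (add_mapMz eps0D) e00 mulrzz mul1r.
case: (kdel _ eps0F) => h; have := h (e i0); rewrite /= nE e00 => n1; [left|right] => b.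
  by rewrite E n1 mulr1z.
by rewrite E n1 mulrNz mulr1z.
Qed.

(** [x] and [al x] both act as transvections, so they have a common nonzero fixed
    vector, and the sign is [+]. *)
Lemma act_aut_tv del w x : functional del -> del w = 0 -> tv del w x ->
  forall b, act (al x) b = act x b.
Proof.
move=> delF delw xtv; have [w0|w0] := eqVneq w 0.
  have xt := tv_triv w0 xtv; have xt' := (aut_triv M nx_inj al x).2 xt.
  by move=> a; rewrite xt xt'.
have [//|h] := act_aut_sign x.
have [del' [w' xT']] := aut_transvection nx_inj al (transvection_of_tv delF w0 delw xtv).
have [del'D _ _ _ xtv'] := transvection_tv xT'.
have [|b b0 [delb [del'b _]]] := @common_kernel _ A _ nx_inj [:: del; del'].
  by split; first exact: (proj1 delF).
have [i /eqP[]] := neq0_coef b0.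
have := congr1 (fa_coef i) (h b); rewrite xtv' xtv delb del'b !mulr0z !addr0 fa_coefN.
lia.
Qed.
End Fixed.

Lemma rigid al : exists y, let al' := aut_mul (conj_aut y) al in
  forall del w x, functional del -> del w = 0 -> tv del w x ->
  forall b, act (al' x) b = act x b.
Proof.
have [y1 fix0] := straighten M nx_inj al eps0F.
have [|c [y2 [c0 [f0 f1]]]] := @straighten_two (aut_mul (conj_aut y1) al).
  by move=> u z uK ztv; rewrite mulr1z; apply: fix0.
exists (y1 * y2)%g => al'.
have al'E x : al' x = aut_mul (conj_aut y2) (aut_mul (conj_aut y1) al) x.
  by rewrite /= conjgM.
move=> del w x delF delw xtv b; rewrite al'E.
exact: (act_aut_tv c0 f0 f1 delF delw xtv).
Qed.

End Straightening.

(** * Completeness *)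
Section Completeness.
Variables (X : choiceType) (A : freeAbelian X) (L : exteriorSquare A).
Variables (G : groupType) (M : linearModel L G).
Variable nx : nat -> X.
Hypothesis nx_inj : injective nx.
Local Notation "a @_ i" := (fa_coef i a).
Local Notation e := (basis A).
Local Notation wedge := (wedge L).
Local Notation act := (act M).
Local Notation eact := (eact M).
Local Notation ia := (ia M).
Local Notation hom_comm := (hom_comm M).
Local Notation triv := (triv M).
Local Notation tv := (tv M).
Local Notation conj_aut := (@conj_aut G).
Implicit Types (a b u v w : A) (i j k : X) (z t : L) (x y : G) (phi psi : A -> L).
Implicit Types (eps del : A -> int) (al : aut G).





Lemma aut_funV (al : aut G) x : al x^-1%g = (al x)^-1%g.
Proof. exact: gmulfV. Qed.

Local Notation D i z := (ia (fun b => z *~ fa_coef i b)).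

Lemma is_add_coefM i z : is_add (fun b => z *~ b@_i).
Proof. by apply: is_add_rank1; exact: fa_coef_is_add. Qed.

Lemma rank1D i z t : D i (z + t) = (D i z * D i t)%g.
Proof.
rewrite -iaD; try exact: is_add_coefM.
by apply: ia_ext => b; rewrite mulrzDl.
Qed.

Lemma rank1N i z : D i (- z) = (D i z)^-1%g.
Proof.
rewrite -iaN; last exact: is_add_coefM.
by apply: ia_ext => b; rewrite mulNrz.
Qed.

Lemma rank1_0 i : D i 0 = 1%g.
Proof. by rewrite -(ia0 M); apply: ia_ext => b; rewrite mul0rz. Qed.

Lemma rank1_coef_inj i z t : D i z = D i t -> z = t.
Proof.
move=> h; have := rank1_inj nx_inj (@fa_coef_is_add _ A i) h (e i).
by rewrite fa_coef_basis eqxx !mulr1z.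
Qed.

Section Scalar.
Variable al : aut G.
Hypothesis al_tv : forall del w x, functional del -> del w = 0 -> tv del w x ->
  forall b, act (al x) b = act x b.

Let al_ia phi : is_add phi -> exists2 phi', is_add phi' & al (ia phi) = ia phi'.
Proof.
move=> phiD; have /(aut_triv M nx_inj al) := triv_ia M phiD.
by move=> /act_trivial[psi psiD E]; exists psi.
Qed.

(** The double commutators of [ia phi] and of its image, divided by [-2], which
    [triv_sq_inj] allows. *)
Let al_contract phi phi' eps u : functional eps -> eps u = 0 ->
  is_add phi -> is_add phi' -> al (ia phi) = ia phi' ->
  al (ia (fun b => wedge u (iota eps (phi u)) *~ eps b)) =
  ia (fun b => wedge u (iota eps (phi' u)) *~ eps b).
Proof.
move=> epsF epsu phiD phi'D alphi; have epsD := proj1 epsF.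
have [x xtv] := tv_lift M epsD epsu.
have xtv' : tv eps u (al x) by move=> b; rewrite (al_tv epsF epsu xtv).
have dbl z : ia (fun b => z *~ -2 *~ eps b) =
    ((ia (fun b => z *~ eps b))^-1 * (ia (fun b => z *~ eps b))^-1)%g.
  have zD := is_add_rank1 (L := L) z epsD.
  rewrite -iaN // -iaD; try exact: is_addN.
  by apply: ia_ext => b; apply: es_coef_ext => i j; rewrite !es_coefE; ring.
have h : al [~ ia phi, x, x]%g = [~ ia phi', al x, al x]%g by rewrite -alphi -!gmulfR.
move: h; rewrite (comm2_tv epsD epsu xtv phiD) (comm2_tv epsD epsu xtv' phi'D) !dbl.
rewrite aut_morph (aut_funV al) => h; apply: (triv_sq_inj nx_inj (M := M)).
- by apply/(aut_triv M nx_inj al)/(triv_ia M)/is_add_rank1.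
- by apply/(triv_ia M)/is_add_rank1.
by apply: invg_inj; rewrite !invgM.
Qed.

Let al_conj phi phi' del w x : functional del -> del w = 0 -> tv del w x ->
  is_add phi -> is_add phi' -> al (ia phi) = ia phi' ->
  al (ia (fun b => eact x^-1%g (phi (act x b)))) =
  ia (fun b => eact x^-1%g (phi' (act x b))).
Proof.
move=> delF delw xtv phiD phi'D alphi.
transitivity (ia phi' ^ al x)%g; first by rewrite -iaJ // -alphi -gmulfJ.
rewrite iaJ //; apply: ia_ext => b.
rewrite (al_tv delF delw xtv) //; apply: eact_eq => a; apply: act_eqV => d.
exact: al_tv delF delw xtv _.
Qed.

Let iota_basis i j k : i != j -> i != k ->
  iota (fa_coef i) (wedge (e i) (e k)) = e k /\
  wedge (e j) (iota (fa_coef i) (wedge (e i) (e k) *~ (e j)@_j)) = wedge (e j) (e k).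
Proof.
move=> ij ik; have E : iota (fa_coef i) (wedge (e i) (e k)) = e k.
  rewrite iota_wedge; last exact: fa_coef_is_add.
  by rewrite !fa_coef_basis eqxx eq_sym (negPf ik) mulr1z mulr0z subr0.
by split=> //; rewrite fa_coef_basis eqxx mulr1z E.
Qed.

Let rank1_image i j k : i != j -> i != k -> exists y : A,
  al (D i (wedge (e j) (e k))) = D i (wedge (e j) y).
Proof.
move=> ij ik; pose phi b := wedge (e i) (e k) *~ b@_j.
have phiD : is_add phi by apply: is_add_coefM.
have [phi' phi'D alphi] := al_ia phiD.
have ej : (e j)@_i = 0 by rewrite fa_coef_basis eq_sym (negPf ij).
have := al_contract (functional_coef A i) ej phiD phi'D alphi.
by rewrite /phi (iota_basis ij ik).2 => ->; exists (iota (fa_coef i) (phi' (e j))).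
Qed.

Let good c i z := al (D i z) = D i (z *~ c).

Let goodD c i z t : good c i z -> good c i t -> good c i (z + t).
Proof. by move=> hz ht; rewrite /good rank1D aut_morph hz ht mulrzDl rank1D. Qed.
Let goodN c i z : good c i z -> good c i (- z).
Proof. by move=> hz; rewrite /good rank1N (aut_funV al) hz mulNrz rank1N. Qed.
Let good0 c i : good c i 0.
Proof. by rewrite /good mul0rz rank1_0 aut_fun1. Qed.

(** By [al_contract], the image of [e_i (x) (e_j /\ e_k)] is a multiple of [e_j]
    wedged with some vector, and also of [e_k] wedged with some vector. *)
Let good_base i j k : i != j -> i != k -> j != k ->
  exists c, good c i (wedge (e j) (e k)).
Proof.
move=> ij ik jk.
have [y yE] := rank1_image ij ik; have [y' y'E] := rank1_image ik ij.
exists y@_k; rewrite /good yE; congr ia; apply/funext => b; congr (_ *~ _).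
have E : wedge (e j) y = - wedge (e k) y'.
  apply: (@rank1_coef_inj i); rewrite -yE rank1N -y'E -(aut_funV al) -rank1N.
  by rewrite -wedgeC.
have -> : y = e j *~ y@_j + e k *~ y@_k.
  apply: fa_coef_ext => q; rewrite !fa_coefE.
  have [<-|jq] := eqVneq j q; first by rewrite eq_sym (negPf jk) mulr1 mulr0 addr0.
  have [<-|kq] := eqVneq k q; first by rewrite mulr0 mulr1 add0r.
  have := congr1 (es_coef j q) E; rewrite !es_coefE /minor !fa_coef_basis eqxx.
  by rewrite (negPf jq) [k == j]eq_sym (negPf jk) (negPf kq) /=; lia.
rewrite wedgeDr !wedgeMzr wedgexx mul0rz add0r !fa_coefE eqxx (negPf jk).
by rewrite mulr0 add0r mulr1.
Qed.

(** Conjugation by the transvection [b |-> b + b_k e_l] adds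
    [- e_i (x) (e_j /\ e_l)] to [e_i (x) (e_j /\ e_k)]. *)
Let good_right (c : int) i j k l : i != j -> i != k -> i != l -> j != k -> j != l -> k != l ->
  good c i (wedge (e j) (e k)) -> good c i (wedge (e j) (e l)).
Proof.
move=> ij ik il jk jl kl H.
have kF := functional_coef A k.
have kel : fa_coef k (e l) = 0 by rewrite fa_coef_basis eq_sym (negPf kl).
have [x xtv] := tv_lift M (proj1 kF) kel.
have E (n : int) : eact x^-1%g (wedge (e j) (e k) *~ n) =
    (wedge (e j) (e k) - wedge (e j) (e l)) *~ n.
  rewrite (add_mapMz (eact_is_add M _)) eact_wedge !(tv_V (proj1 kF) kel xtv).
  rewrite !fa_coef_basis eqxx (negPf jk) mulr0z mulr1z subr0.
  by rewrite wedgeDr wedgeNr.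
have xi b : (act x b)@_i = b@_i.
  by rewrite xtv !fa_coefE eq_sym (negPf il) mulr0 addr0.
have := al_conj kF kel xtv (@is_add_coefM i _) (@is_add_coefM i _) H.
have -> : ia (fun b => eact x^-1%g (wedge (e j) (e k) *~ (act x b)@_i)) =
    D i (wedge (e j) (e k) - wedge (e j) (e l)).
  by apply: ia_ext => b; rewrite E xi.
have -> : ia (fun b => eact x^-1%g (wedge (e j) (e k) *~ c *~ (act x b)@_i)) =
    D i ((wedge (e j) (e k) - wedge (e j) (e l)) *~ c).
  apply: ia_ext => b; rewrite -mulrzA E xi; by rewrite mulrzA.
move=> h.
have -> : wedge (e j) (e l) = wedge (e j) (e k) -
    (wedge (e j) (e k) - wedge (e j) (e l)) by rewrite opprB addrC subrK.
by apply: goodD => //; apply: goodN.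
Qed.

Let good_swap c i j k : good c i (wedge (e j) (e k)) -> good c i (wedge (e k) (e j)).
Proof. by move=> /goodN; rewrite -wedgeC. Qed.

(** Conjugation by the transvection [b |-> b + b_i' e_i] adds
    [e_i' (x) (e_j /\ e_k)] to [e_i (x) (e_j /\ e_k)]. *)
Let good_functional c i i' j k : i != i' -> i != j -> i != k -> i' != j -> i' != k ->
  good c i (wedge (e j) (e k)) -> good c i' (wedge (e j) (e k)).
Proof.
move=> ii' ij ik i'j i'k H.
have i'F := functional_coef A i'.
have i'e : fa_coef i' (e i) = 0 by rewrite fa_coef_basis (negPf ii').
have [x xtv] := tv_lift M (proj1 i'F) i'e.
have E (n : int) : eact x^-1%g (wedge (e j) (e k) *~ n) = wedge (e j) (e k) *~ n.
  rewrite (add_mapMz (eact_is_add M _)) eact_wedge !(tv_V (proj1 i'F) i'e xtv).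
  by rewrite !fa_coef_basis !(eq_sym _ i') (negPf i'j) (negPf i'k) !mulr0z !subr0.
have xi b : (act x b)@_i = b@_i + b@_i'.
  by rewrite xtv !fa_coefE eqxx mulr1.
have F (n : int) : ia (fun b => eact x^-1%g (wedge (e j) (e k) *~ n *~ (act x b)@_i)) =
    (D i (wedge (e j) (e k) *~ n) * D i' (wedge (e j) (e k) *~ n))%g.
  rewrite -iaD; try exact: is_add_coefM.
  by apply: ia_ext => b; rewrite -mulrzA E xi mulrzA mulrzDr.
have := al_conj i'F i'e xtv (@is_add_coefM i (wedge (e j) (e k) *~ 1))
  (@is_add_coefM i (wedge (e j) (e k) *~ c)).
rewrite !F mulr1z aut_morph => /(_ H); rewrite H => /mulgI.
by [].
Qed.

(** Indices are changed one at a time, through two fresh ones. *)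
Let good_all : exists c, forall i j k, i != j -> i != k -> j != k ->
  good c i (wedge (e j) (e k)).
Proof.
have neq m n : m != n -> nx m != nx n by rewrite (inj_eq nx_inj).
have [c base] := good_base (neq 0 1 isT) (neq 0 2 isT) (neq 1 2 isT).
exists c => i j k ij ik jk.
have [l] := fresh nx_inj [fset nx 0; nx 1; nx 2; i; j; k]%fset.
have [m] := fresh nx_inj [fset nx 0; nx 1; nx 2; i; j; k; l]%fset.
rewrite !inE !negb_or => /andP[/andP[/andP[/andP[/andP[/andP[m0 m1] m2] mi] mj] mk] ml].
move=> /andP[/andP[/andP[/andP[/andP[l0 l1] l2] li] lj] lk].
have g1 : good c (nx 0) (wedge (e (nx 1)) (e l)).
  by apply: good_right base; rewrite ?neq // 1?eq_sym.
have g2 : good c (nx 0) (wedge (e l) (e m)).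
  by apply: good_right (good_swap g1); rewrite ?neq // 1?eq_sym // eq_sym.
have g3 : good c i (wedge (e l) (e m)).
  have [<- //|i0] := eqVneq (nx 0) i.
  by apply: good_functional g2; rewrite // eq_sym.
have g4 : good c i (wedge (e l) (e k)).
  by apply: good_right g3; rewrite // eq_sym.
by apply: good_swap; apply: good_right (good_swap g4); rewrite // eq_sym.
Qed.

(** The factor [c] found on the homomorphisms [e_i (x) (u /\ y)] governs all
    [phi], because [phi' - c phi] satisfies the hypothesis of
    [inner_of_contractions] with [m = 0]. It is invertible since a homomorphism
    with a coordinate 1 is in the image. *)
Lemma aut_scalar : exists2 c : int, c = 1 \/ c = -1 &
  forall phi, is_add phi -> al (ia phi) = ia (fun b => phi b *~ c).
Proof.
have [c cP] := good_all.
have good_ker i u (y : A) : u@_i = 0 -> y@_i = 0 -> good c i (wedge u y).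
  pose pr a : A := a - e i *~ a@_i.
  have prD : is_add pr by move=> a b; rewrite /pr fa_coefD mulrzDr opprD addrACA.
  have prE j : pr (e j) = if i == j then 0 else e j.
    rewrite /pr fa_coef_basis eq_sym; case: eqP => [->|_]; last by rewrite mulr0z subr0.
    by rewrite mulr1z subrr.
  have prid a : a@_i = 0 -> pr a = a by rewrite /pr => ->; rewrite mulr0z subr0.
  move=> /prid <- /prid <-; move: u y => a b.
  elim/free_ind: a => [|a a' ha ha'|a ha|j].
  - by rewrite (add_map0 prD) wedge0l; exact: good0.
  - by rewrite prD wedgeDl; exact: goodD.
  - by rewrite (add_mapN prD) wedgeNl; exact: goodN.
  rewrite prE; case: eqP => [_|/eqP ij]; first by rewrite wedge0l; exact: good0.
  elim/free_ind: b => [|a a' ha ha'|a ha|k].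
  - by rewrite (add_map0 prD) wedge0r; exact: good0.
  - by rewrite prD wedgeDr; exact: goodD.
  - by rewrite (add_mapN prD) wedgeNr; exact: goodN.
  rewrite prE; case: eqP => [_|/eqP ik]; first by rewrite wedge0r; exact: good0.
  by have [->|jk] := eqVneq j k; [rewrite wedgexx; exact: good0 | exact: cP].
have neq m n : m != n -> nx m != nx n by rewrite (inj_eq nx_inj).
have scal phi : is_add phi -> al (ia phi) = ia (fun b => phi b *~ c).
  move=> phiD; have [phi' phi'D alphi] := al_ia phiD.
  have [||a [psi [_ h]]] := @inner_of_contractions _ _ L 0 (fun b => phi' b - phi b *~ c)
      (nx 0) (nx 1) (neq 0 1 isT)%N.
  - by apply: is_addD => //; apply: is_addN; apply: is_addMz.
  - move=> i u ui k l; rewrite dvd0z; apply/eqP.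
    have iD := @fa_coef_is_add _ A i.
    have := al_contract (functional_coef A i) ui phiD phi'D alphi.
    have gd : good c i (wedge u (iota (fa_coef i) (phi u))).
      by apply: good_ker => //; exact: es_coef_diag.
    rewrite gd => /rank1_coef_inj E.
    have I := @iota_is_add _ _ L (fa_coef i).
    rewrite (add_mapB I) (add_mapMz I) -(es_coef_wedge L) wedgeDr wedgeNr wedgeMzr E.
    by rewrite subrr es_coef0.
  rewrite alphi; apply/eqP; rewrite -divg_eq1; apply/eqP.
  rewrite -iaN; last exact: is_addMz.
  rewrite -iaD //; last by apply: is_addN; apply: is_addMz.
  apply/(ia_eq1 M); first by apply: is_addD => //; apply: is_addN; apply: is_addMz.
  by exists a => b; rewrite h mulr0z addr0.
exists c => //.
pose z := wedge (e (nx 1)) (e (nx 2)).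
have zt : triv (D (nx 0) z) by apply/(triv_ia M)/is_add_coefM.
have /act_trivial[phi phiD phiE] : triv (aut_inv_fun al (D (nx 0) z)).
  by apply/(aut_triv M nx_inj al); rewrite aut_inv_funK.
have := scal _ phiD; rewrite -phiE aut_inv_funK => /ia_inj[||a aP].
- exact: is_add_coefM.
- exact: is_addMz.
have := congr1 (es_coef (nx 1) (nx 2)) (aP (e (nx 0))).
rewrite /z !es_coefE /minor !fa_coef_basis !(inj_eq nx_inj) /= => h.
have cn : c * es_coef (nx 1) (nx 2) (phi (e (nx 0))) = 1 by move: h; lia.
have : `|c|%N = 1%N.
  have : (`|c| * `|es_coef (nx 1) (nx 2) (phi (e (nx 0)))|)%N = 1%N by rewrite -abszM cn.
  by move/eqP; rewrite muln_eq1 => /andP[/eqP].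
by lia.
Qed.
End Scalar.


(** The relation between the values at [th] and at [x] of the cocycle
    [y |-> y^-1 al(y)], when [th] inverts its values: [k] is a commutator of [th]
    and [x], and the second hypothesis is the image of the first. *)
Lemma twist_square (th x v c k : G) : (th * x = x * th * k)%g ->
  ((th * v) * (x * c) = (x * c) * (th * v) * k)%g -> (c ^ th = c^-1)%g ->
  commute c^-1%g k -> commute v k -> commute c (v ^ x)%g ->
  (c * c = v * (v ^ x)^-1)%g.
Proof.
move=> thx h cth ck vk cvx.
have {}h : (k * (v ^ x * c) = c^-1 * (v * k))%g.
  apply: (mulgI (x * th)%g); rewrite -cth mulgA -thx.
  transitivity ((th * v) * (x * c))%g; last first.
    by rewrite h -(mulgA x c) (mulgA c th v) (conjgC c th) !mulgA.
  by rewrite -[RHS]mulgA (mulgA v x c) (conjgC v x) !mulgA.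
have {}h : (v ^ x * c = c^-1 * v)%g.
  by apply: (mulgI k); rewrite h vk !mulgA ck.
by apply: (mulIg (v ^ x)%g); rewrite mulgVK -mulgA cvx h mulVKg.
Qed.

(** [x] and [al x] conjugate V in the same way, so [c x = x^-1 al(x)] lies in V.
    With [th] acting as [-1] and [v0 = c th], [twist_square] gives
    [(c x)^2 = v0 (v0^x)^-1]. For the transvections [x] with a coordinate
    functional, this is the hypothesis of [inner_of_contractions] with [m = 2]
    for [v0], so [v0] is a square [w^2] and [c x = w (w^x)^-1]. *)
Lemma inner_of_fixing al : (forall v : G, triv v -> al v = v) -> is_inner al.
Proof.
move=> alv.
have al_act x : triv (x^-1 * al x)%g.
  apply: (double_comm_triv nx_inj) => v vt.
  suff -> : [~ v, x^-1 * al x]%g = 1%g by rewrite comm1g.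
  apply/eqP/conjg_fixP.
  have vt' : triv (v ^ x^-1)%g by exact: trivJ.
  rewrite conjgM -{1}(alv _ vt') -gmulfJ conjgKV; exact: alv.
have [th thE] := exists_minus M.
pose v0 := (th^-1 * al th)%g.
have v0t : triv v0 by exact: al_act.
pose c x := (x^-1 * al x)%g.
have ct x : triv (c x) by exact: al_act.
have alE x : al x = (x * c x)%g by rewrite /c mulVKg.
have c2 x : (c x * c x = v0 * (v0 ^ x)^-1)%g.
  pose k := [~ th, x]%g.
  have kt : triv k.
    move=> a; rewrite /k /commg /conjg !actM.
    have thV b : act th^-1%g b = - b.
      by apply: (@act_inj _ _ _ _ M th); rewrite actVK thE opprK.
    by rewrite thE thV (add_mapN (act_is_add M x^-1%g)) opprK actK.
  have kE : (th * x = x * th * k)%g by rewrite /k -commgC.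
  have v0xt : triv (v0 ^ x)%g by exact: trivJ.
  have alk : (al th * al x = al x * al th * k)%g.
    by rewrite -[X in _ = (_ * X)%g](alv k kt) -!aut_morph kE.
  apply: (twist_square (th := th) (v := v0) kE).
  - by rewrite -(alE x) -[(th * v0)%g]/(th * c th)%g -(alE th).
  - exact: minus_conj.
  - exact: triv_comm (trivV (ct x)) kt.
  - exact: triv_comm v0t kt.
  - exact: triv_comm (ct x) v0xt.
suff [w wt v0w] : exists2 w : G, triv w & v0 = (w * w)%g.
  exists w => x; have wxt : triv (w ^ x)%g by exact: trivJ.
  have cE : c x = (w * (w ^ x)^-1)%g.
    apply: (triv_sq_inj nx_inj (M := M)) => //; first exact: trivM (trivV _).
    rewrite c2 v0w conjMg invgM -!mulgA; congr (_ * _)%g.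
    rewrite !mulgA; congr (_ * _)%g.
    exact: (triv_comm wt (trivV wxt)).
  by rewrite alE cE (triv_comm wt (trivV wxt)) -conjVg /conjg !mulgA mulgV mul1g.
have [phi phiD v0E] := act_trivial v0t.
have neq m n : m != n -> nx m != nx n by rewrite (inj_eq nx_inj).
have [|a [psi [psiD h]]] := @inner_of_contractions _ _ L 2 phi _ _ (neq 0 1 isT)%N phiD.
  move=> i u ui k l.
  have iD := @fa_coef_is_add _ A i.
  have [x xtv] := tv_lift M iD ui.
  have [psi psiD cE] := act_trivial (ct x).
  have [a aP] : exists a, forall b, - hom_comm x phi b - psi b *~ 2 = wedge b a.
    have nD := is_addN (is_add_hom_comm M x phiD).
    have pD : is_add (fun b => psi b *~ 2) by apply: is_addMz.
    apply: (ia_inj (M := M) nD pD).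
    rewrite (iaN M (is_add_hom_comm M x phiD)) -comm_ia // -v0E invgR commgEr.
    transitivity (c x * c x)%g; last first.
      by rewrite cE -iaD //; apply: ia_ext => b.
    by rewrite c2 conjVg (triv_comm v0t (trivV (trivJ _ v0t))).
  have {}aP b : b@_i = 0 ->
      wedge u (iota (fa_coef i) (phi b)) - psi b *~ 2 = wedge b a.
    by move=> bi; rewrite -aP (hom_comm_tv iD ui xtv) // bi mulr0z sub0r opprK.
  have [s sP] := finite_support u.
  (* At basis vectors outside the support of [u], the equation says that [a] is
     a multiple of [u] modulo 2. *)
  have am j m : j != m -> j != i -> u@_j = 0 ->
      (2 %| a@_m + u@_m * (iota (fa_coef i) (phi (e j)))@_j)%Z.
    move=> jm ji uj.
    have eji : (e j)@_i = 0 by rewrite fa_coef_basis (negPf ji).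
    have := congr1 (es_coef j m) (aP (e j) eji).
    rewrite !es_coefE /minor !fa_coef_basis eqxx (negPf jm) uj.
    set y := iota _ _; set t := es_coef _ _ _ => hm.
    have -> : a@_m + u@_m * y@_j = t * -2 by lia.
    by rewrite dvdz_mull.
  have [j] := fresh nx_inj (i |` (k |` (l |` s)))%fset.
  rewrite !in_fset1U !negb_or => /andP[ji /andP[jk /andP[jl /sP uj]]].
  have hk := am j k jk ji uj; have hl := am j l jl ji uj.
  have := congr1 (es_coef k l) (aP u ui); rewrite !es_coefE => hkl.
  set y := (iota _ (phi (e j)))@_j in hk hl.
  have -> : minor k l u (iota (fa_coef i) (phi u)) =
      u@_k * (a@_l + u@_l * y) - u@_l * (a@_k + u@_k * y)
      + es_coef k l (psi u) * 2.
    apply/eqP; rewrite -subr_eq; apply/eqP; move: hkl; rewrite /minor => hkl.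
    have -> : es_coef k l (psi u) * 2 = 2 * es_coef k l (psi u) by rewrite mulrC.
    rewrite hkl; ring.
  by rewrite rpredD ?rpredB // ?dvdz_mull // mulrC dvdz_mulr.
exists (ia psi); first exact: triv_ia.
have psi2D : is_add (fun b => psi b *~ 2) by apply: is_addMz.
rewrite v0E -iaD //; apply/eqP; rewrite -divg_eq1 -iaN; last exact: is_addD.
rewrite -iaD //; last by apply: is_addN; apply: is_addD.
apply/eqP/(ia_eq1 M); first by apply: is_addD => //; apply: is_addN; apply: is_addD.
exists a => b; rewrite h; apply: es_coef_ext => p q; rewrite !es_coefE; ring.
Qed.

Theorem model_complete : complete_group G.
Proof.
split.
  apply/seteqP; split=> [x xc|x ->]; first exact: (model_center M nx_inj xc).
  by move=> y; rewrite /commute mul1g mulg1.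
move=> al; have [y al_tv] := rigid M nx_inj al.
apply: (@inner_conj_aut _ al y); move: (aut_mul _ al) al_tv => {}al al_tv.
have [c c1 alc] := aut_scalar al_tv.
have [th thE] := exists_minus M.
case: c1 => cE.
  apply: inner_of_fixing => v /act_trivial[phi phiD ->]; rewrite alc // cE.
  by apply: ia_ext => b; rewrite mulr1z.
apply: (@inner_conj_aut _ al th); apply: inner_of_fixing => v vt.
have /act_trivial[phi phiD vE] := vt; rewrite /= vE alc // cE.
have -> : ia (fun b => phi b *~ -1) = (ia phi)^-1%g.
  by rewrite -iaN //; apply: ia_ext => b; rewrite mulrNz mulr1z.
by rewrite -vE (minus_conj thE (trivV vt)) invgK.
Qed.

End Completeness.

(** * Free groups of class two *)

Definition class2 (G : groupType) := forall x y z : G, commute [~ x, y]%g z.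

Section Class2.
Variable G : groupType.
Hypothesis G2 : class2 G.
Implicit Types x y z : G.

Lemma class2_commMl x y z : [~ x * y, z]%g = ([~ x, z] * [~ y, z])%g.
Proof.
transitivity (y^-1 * ([~ x, z] * y ^ z))%g.
  by rewrite /commg /conjg invgM !mulgA mulgK.
by rewrite [LHS]mulgA -(G2 x z y^-1%g) -[LHS]mulgA -commgEl.
Qed.

Lemma class2_commMr x y z : [~ z, x * y]%g = ([~ z, x] * [~ z, y])%g.
Proof.
rewrite -invgR class2_commMl invgM !invgR; exact: G2.
Qed.
End Class2.

(** The universal property of the free group of class two, restricted to
    groups of class two; uniqueness holds for arbitrary targets. *)
Record relativelyFree2 (X : Type) (N : groupType) (b : X -> N) := RelativelyFree2 {
  rf_class2 : class2 N;
  rf_extend : forall (H : groupType) (f : X -> H), class2 H ->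
    exists2 phi : N -> H, {morph phi : x y / (x * y)%g} & forall i, phi (b i) = f i;
  rf_unique : forall (H : groupType) (phi psi : N -> H),
    {morph phi : x y / (x * y)%g} -> {morph psi : x y / (x * y)%g} ->
    (forall i, phi (b i) = psi (b i)) -> phi =1 psi
}.

Lemma morph_group1 (G H : groupType) (phi : G -> H) :
  {morph phi : x y / (x * y)%g} -> phi 1%g = 1%g.
Proof. by move=> phiM; apply: (mulgI (phi 1%g)); rewrite -phiM !mulg1. Qed.

Lemma morph_groupV (G H : groupType) (phi : G -> H) :
  {morph phi : x y / (x * y)%g} -> {morph phi : x / x^-1%g}.
Proof.
move=> phiM x; apply: (mulgI (phi x)).
by rewrite -phiM !mulgV morph_group1.
Qed.

Lemma morph_groupR (G H : groupType) (phi : G -> H) :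
  {morph phi : x y / (x * y)%g} -> {morph phi : x y / [~ x, y]%g}.
Proof. by move=> phiM x y; rewrite /commg /conjg !phiM !(morph_groupV phiM). Qed.

Section Derived.
Variable G : groupType.

Definition derived : set G := commutator [set: G]%classic [set: G]%classic.

Lemma derived_comm x y : derived [~ x, y]%g.
Proof. by move=> K [_]; apply; exists x => //; exists y. Qed.

Lemma commutator_min (A B K : set G) : is_subgroup K ->
  (forall x y, A x -> B y -> K [~ x, y]%g) -> forall x, commutator A B x -> K x.
Proof. by move=> KG KR x; apply; split=> // _ [y Ay [z Bz <-]]; exact: KR. Qed.

Lemma derived_min (K : set G) : is_subgroup K -> (forall x y, K [~ x, y]%g) ->
  forall x, derived x -> K x.
Proof. by move=> KG KR; apply: commutator_min. Qed.

Lemma derived_subgroup : is_subgroup derived.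
Proof. exact: commutator_subgroup. Qed.

Lemma derived_conjg x y : derived x -> derived (x ^ y)%g.
Proof. exact: commutator_conjg. Qed.

Definition derived_normal : normalSubgroup G :=
  NormalSubgroup derived_subgroup derived_conjg.
End Derived.

Section QuotientMorphism.
Variables (G : groupType) (K : normalSubgroup G).
Local Notation Q := (quotient_group K).

Lemma quot_piM : {morph (\pi_Q : G -> Q) : x y / (x * y)%g}.
Proof. by move=> x y; exact: esym (quot_mulE K x y). Qed.

Lemma quot_pi_eq x y : (\pi_Q x = \pi_Q y) <-> K (x^-1 * y)%g.
Proof.
split=> [xy|Kxy]; first by apply/quot_eqP; rewrite xy.
by apply/eqP/quot_eqP.
Qed.

Lemma quot_pi_eq1 x : (\pi_Q x = 1%g) <-> K x.
Proof.
have -> : (1%g : Q) = \pi_Q 1%g by [].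
split=> [/esym/quot_pi_eq|Kx]; first by rewrite invg1 mul1g.
by apply/esym/quot_pi_eq; rewrite invg1 mul1g.
Qed.
End QuotientMorphism.

(** A homomorphism from the free group to a group of class two kills the third
    term of the lower central series, so it factors through [N]. *)
Lemma relatively_free_of_free X (N : groupType) : free_nilpotent2 X N ->
  exists b : X -> N, relativelyFree2 b.
Proof.
move=> [F [b [Ffree [f [g fK gK]]]]].
pose Q := quotient_group (gamma3 F).
pose p x : N := g (\pi_Q x).
have gM : {morph g : x y / (x * y)%g}.
  by move=> x y; apply: (can_inj fK); rewrite gmulfM !gK.
have pM : {morph p : x y / (x * y)%g} by move=> x y; rewrite /p quot_piM gM.
have p_onto x : exists y, p y = x by exists (repr (f x)); rewrite /p reprK fK.
have p_eq x y : p x = p y <-> gamma3 F (x^-1 * y)%g.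
  rewrite -quot_pi_eq /p; split=> [|-> //]; exact: (can_inj gK).
exists (p \o b); split.
- move=> x y z; have [x' <-] := p_onto x; have [y' <-] := p_onto y.
  have [z' <-] := p_onto z.
  apply/commgP; rewrite -!(morph_groupR pM) -(morph_group1 pM); apply/eqP.
  apply/esym/p_eq; rewrite invg1 mul1g => K [_]; apply.
  by exists [~ x', y']%g; [exact: derived_comm | exists z'].
- move=> H h H2; have [phi [[phiM phib] _]] := Ffree H h.
  have kill x : gamma3 F x -> phi x = 1%g.
    apply: (commutator_min (K := [set x | phi x = 1%g]%classic)).
      split=> /=; first exact: morph_group1.
        by move=> u v; rewrite phiM => -> ->; rewrite mulg1.
      by move=> u; rewrite (morph_groupV phiM) => ->; rewrite invg1.
    move=> u v du _ /=; rewrite (morph_groupR phiM); apply/eqP/commgP.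
    apply: (derived_min (K := [set u | commute (phi u) (phi v)]%classic)) du.
      split=> /=.
      + by rewrite (morph_group1 phiM); exact/commute_sym/commute1.
      + move=> s t hs ht; rewrite phiM; apply: commute_sym.
        by apply: commuteM; apply: commute_sym.
      + move=> s hs; rewrite (morph_groupV phiM); apply: commute_sym.
        by apply: commuteV; apply: commute_sym.
    by move=> s t /=; rewrite (morph_groupR phiM); exact: H2.
  have phiE x y : p x = p y -> phi x = phi y.
    move/p_eq/kill; rewrite phiM (morph_groupV phiM) => /(congr1 (fun z => phi x * z)%g).
    by rewrite mulVKg mulg1.
  have [s sP] := choice p_onto.
  exists (phi \o s) => [x y|i] /=; last by rewrite -phib; apply: phiE; rewrite sP.
  by rewrite -phiM; apply: phiE; rewrite pM !sP.
- move=> H phi psi phiM psiM hb x; have [y <-] := p_onto x.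
  have [chi [_ chiU]] := Ffree H (phi \o p \o b).
  have /chiU h1 : {morph phi \o p : x y / (x * y)%g} /\ (phi \o p) \o b = phi \o p \o b.
    by split=> // u v /=; rewrite pM phiM.
  have /chiU h2 : {morph psi \o p : x y / (x * y)%g} /\ (psi \o p) \o b = phi \o p \o b.
    by split=> [u v /=|]; [rewrite pM psiM | apply/funext => i /=; rewrite hb].
  by have := congr1 (@^~ y) h1; rewrite /= h2.
Qed.

(** * A group of class two on vectors and matrices *)

Section Tensor.
Variables (X : choiceType) (A : freeAbelian X) (A2 : freeAbelian (X * X)%type).

Definition tensor (a b : A) : A2 :=
  lift (fun i => lift (fun j => basis A2 (i, j)) b) a.

Lemma tensorDl b : is_add (tensor^~ b).
Proof. exact: lift_is_add. Qed.

Lemma tensorDr a : is_add (tensor a).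
Proof.
move=> b b'; rewrite /tensor; move: a; apply: eq_add_map.
- exact: lift_is_add.
- by apply: is_addD; exact: lift_is_add.
- by move=> i; rewrite !lift_basis lift_is_add.
Qed.

Lemma tensor_basis i j : tensor (basis A i) (basis A j) = basis A2 (i, j).
Proof. by rewrite /tensor !lift_basis. Qed.

Lemma eq_biadditive (V : zmodType) (f g : A -> A -> V) :
  (forall b, is_add (f^~ b)) -> (forall a, is_add (f a)) ->
  (forall b, is_add (g^~ b)) -> (forall a, is_add (g a)) ->
  (forall i j, f (basis A i) (basis A j) = g (basis A i) (basis A j)) ->
  forall a b, f a b = g a b.
Proof.
move=> fl fr gl gr fg a b; move: a; apply: eq_add_map => // i.
exact: (eq_add_map (f := f (basis A i)) (g := g (basis A i))).
Qed.
End Tensor.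

Section Heisenberg.
Variables (X : choiceType) (A : freeAbelian X) (A2 : freeAbelian (X * X)%type).
Local Notation "a \ox b" := (@tensor X A A2 a b) (at level 40).

(** The free group of class two embeds in this larger group. With the full tensor
    square as second factor, the cocycle is bilinear without any ordering of the
    basis. *)
Definition heis := (A * A2)%type.
HB.instance Definition _ := Choice.on heis.

Definition heis_one : heis := (0, 0).
Definition heis_mul (x y : heis) : heis := (x.1 + y.1, x.2 + y.2 + x.1 \ox y.1).
Definition heis_inv (x : heis) : heis := (- x.1, - x.2 + x.1 \ox x.1).

Lemma tensor0l b : 0 \ox b = 0. Proof. exact: (add_map0 (@tensorDl _ A A2 b)). Qed.
Lemma tensor0r a : a \ox 0 = 0. Proof. exact: (add_map0 (@tensorDr _ A A2 a)). Qed.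
Lemma tensorNl a b : (- a) \ox b = - (a \ox b).
Proof. exact: (add_mapN (@tensorDl _ A A2 b)). Qed.
Lemma tensorNr a b : a \ox (- b) = - (a \ox b).
Proof. exact: (add_mapN (@tensorDr _ A A2 a)). Qed.

Lemma heis_mulA : associative heis_mul.
Proof.
move=> [a s] [b t] [c r]; congr pair => /=; first by rewrite addrA.
by rewrite tensorDl tensorDr; apply: fa_coef_ext => i; rewrite !fa_coefD; ring.
Qed.
Lemma heis_mul1g : left_id heis_one heis_mul.
Proof. by move=> [a s]; rewrite /heis_mul /= tensor0l !add0r addr0. Qed.
Lemma heis_mulg1 : right_id heis_one heis_mul.
Proof. by move=> [a s]; rewrite /heis_mul /= tensor0r !addr0. Qed.
Lemma heis_mulVg : left_inverse heis_one heis_inv heis_mul.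
Proof.
move=> [a s]; congr pair; rewrite /= ?addNr // tensorNl; apply: fa_coef_ext => i.
by rewrite !fa_coefE; ring.
Qed.
Lemma heis_mulgV : right_inverse heis_one heis_inv heis_mul.
Proof.
move=> [a s]; congr pair; rewrite /= ?subrr // tensorNr; apply: fa_coef_ext => i.
by rewrite !fa_coefE; ring.
Qed.

HB.instance Definition _ := isGroup.Build heis
  heis_mulA heis_mul1g heis_mulg1 heis_mulVg heis_mulgV.

Lemma heis_mulE (x y : heis) : (x * y)%g = (x.1 + y.1, x.2 + y.2 + x.1 \ox y.1).
Proof. by []. Qed.

Lemma heis_center (x y : heis) : x.1 = 0 -> commute x y.
Proof.
case: x y => [a s] [b t] /= ->; rewrite /commute !heis_mulE /=.
by rewrite tensor0l tensor0r !addr0 add0r [s + t]addrC.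
Qed.

Lemma heis_comm (x y : heis) : [~ x, y]%g = (0, x.1 \ox y.1 - y.1 \ox x.1).
Proof.
apply: (mulgI (y * x)%g); rewrite -commgC; case: x y => [a s] [b t].
rewrite !heis_mulE /= tensor0r !addr0 addrC; congr pair.
by rewrite -[in RHS]addrA [b \ox a + _]addrC subrK [t + s]addrC.
Qed.

Lemma heis_class2 : class2 heis.
Proof. by move=> x y z; apply: heis_center; rewrite heis_comm. Qed.
End Heisenberg.

Section Multiplicative.
Variable V : zmodType.
Definition multiplicative_of := (V : Type).
HB.instance Definition _ := Choice.copy multiplicative_of V.
HB.instance Definition _ := isGroup.Build multiplicative_of
  (@addrA V) (@add0r V) (@addr0 V) (@addNr V) (@subrr V).
End Multiplicative.

Section Additive.
Variable G : groupType.
Hypothesis GC : forall x y : G, commute x y.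
(** The proof of commutativity is an argument, for the additive structure to be
    found from the type. *)
Definition additive_of := (fun _ : (forall x y : G, commute x y) => (G : Type)) GC.
HB.instance Definition _ := Choice.copy additive_of G.
HB.instance Definition _ := GRing.isZmodule.Build additive_of
  (@mulgA G) GC (@mul1g G) (@mulVg G).
End Additive.

(** * The derived subgroup as an exterior square *)
Section Commutators.
Variables (X : choiceType) (A : freeAbelian X) (A2 : freeAbelian (X * X)%type).
Variables (x0 : X) (N : groupType) (b : X -> N).
Hypothesis RF : relativelyFree2 b.
Local Notation e := (basis A).
Local Notation tensor := (@tensor X A A2).
Implicit Types (x y : N) (i j : X) (a c : A).

Let N2 := rf_class2 RF.

Lemma kappa_subproof : exists kappa : N -> heis A A2,
  {morph kappa : x y / (x * y)%g} /\ forall i, kappa (b i) = (e i, 0).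
Proof.
have [phi phiM phib] := rf_extend RF (fun i => (e i, 0) : heis A A2) (heis_class2 (A2 := A2)).
by exists phi.
Qed.
Definition kappa := projT1 (cid kappa_subproof).
Lemma kappaM : {morph kappa : x y / (x * y)%g}.
Proof. by rewrite /kappa; case: cid => k []. Qed.
Lemma kappa_b i : kappa (b i) = (e i, 0).
Proof. by rewrite /kappa; case: cid => k []. Qed.

Definition ab x : A := (kappa x).1.

Lemma abM x y : ab (x * y)%g = ab x + ab y.
Proof. by rewrite /ab kappaM. Qed.
Lemma ab1 : ab 1%g = 0.
Proof. by rewrite /ab (morph_group1 kappaM). Qed.
Lemma abV x : ab x^-1%g = - ab x.
Proof. by rewrite /ab (morph_groupV kappaM). Qed.
Lemma ab_comm x y : ab [~ x, y]%g = 0.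
Proof. by rewrite /ab (morph_groupR kappaM) heis_comm. Qed.
Lemma ab_b i : ab (b i) = e i.
Proof. by rewrite /ab kappa_b. Qed.

Lemma eq_on_basis (V : zmodType) (f g : N -> V) :
  (forall x y, f (x * y)%g = f x + f y) -> (forall x y, g (x * y)%g = g x + g y) ->
  (forall i, f (b i) = g (b i)) -> f =1 g.
Proof. exact: (rf_unique RF (H := multiplicative_of V)). Qed.

Lemma ab_onto a : exists x, ab x = a.
Proof.
elim/free_ind: a => [|a c [x <-] [y <-]|a [x <-]|i].
- by exists 1%g; rewrite ab1.
- by exists (x * y)%g; rewrite abM.
- by exists x^-1%g; rewrite abV.
- by exists (b i); rewrite ab_b.
Qed.

(** [A] maps to the abelianization of [N] by the images of the basis, and the
    composite from [N] is the quotient map, as it is on the basis. *)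
Lemma derived_of_ab x : ab x = 0 -> derived x.
Proof.
pose Q := quotient_group (derived_normal N).
have QC (u v : Q) : commute u v.
  elim/quot_ind: u => u; elim/quot_ind: v => v.
  by rewrite /commute -!quot_piM; apply/quot_pi_eq;
    rewrite invgM -mulgA -[(_ * _)%g]/[~ v, u]%g; exact: derived_comm.
pose sig := lift (f := A) (V := additive_of QC) (fun i => \pi_Q (b i)).
have sigD : is_add sig by exact: (lift_is_add (f := A) (V := additive_of QC)).
have sigE : sig \o ab =1 (\pi_Q : N -> additive_of QC).
  apply: eq_on_basis => [y z|y z|i] /=.
  - by rewrite abM sigD.
  - exact: quot_piM.
  - by rewrite ab_b /sig lift_basis.
move=> abx; apply/(quot_pi_eq1 (derived_normal N)).
by have := sigE x; rewrite /= abx (add_map0 sigD) => <-.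
Qed.

Lemma ab_central x y : ab x = 0 -> commute x y.
Proof.
move=> /derived_of_ab dx.
apply: (derived_min (K := [set u | commute u y]%classic) _ _ dx); last first.
  by move=> u v; exact: N2.
split=> [|u v|u] /=; first exact/commute_sym/commute1.
  by move=> hu hv; apply/commute_sym/commuteM; apply/commute_sym.
by move=> hu; apply/commute_sym/commuteV/commute_sym.
Qed.

(** The derived subgroup, by [derived_of_ab]. *)
Definition ext := {x : N | ab x == 0}.
HB.instance Definition _ := SubChoice.copy ext {x : N | ab x == 0}.

Lemma ext_ab (z : ext) : ab (val z) = 0. Proof. exact/eqP/(valP z). Qed.

Lemma ext_add_subproof (z t : ext) : ab (val z * val t)%g == 0.
Proof. by rewrite abM !ext_ab addr0. Qed.
Lemma ext_opp_subproof (z : ext) : ab (val z)^-1%g == 0.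
Proof. by rewrite abV ext_ab oppr0. Qed.
Lemma ext_zero_subproof : ab 1%g == 0.
Proof. by rewrite ab1. Qed.
Definition ext_add z t : ext := exist _ (val z * val t)%g (ext_add_subproof z t).
Definition ext_opp z : ext := exist _ (val z)^-1%g (ext_opp_subproof z).
Definition ext_zero : ext := exist _ 1%g ext_zero_subproof.

Lemma ext_addA : associative ext_add.
Proof. by move=> z t r; apply: val_inj; rewrite /= mulgA. Qed.
Lemma ext_addC : commutative ext_add.
Proof. by move=> z t; apply: val_inj; rewrite /=; apply: ab_central; exact: ext_ab. Qed.
Lemma ext_add0 : left_id ext_zero ext_add.
Proof. by move=> z; apply: val_inj; rewrite /= mul1g. Qed.
Lemma ext_addN : left_inverse ext_zero ext_opp ext_add.
Proof. by move=> z; apply: val_inj; rewrite /= mulVg. Qed.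
HB.instance Definition _ := GRing.isZmodule.Build ext
  ext_addA ext_addC ext_add0 ext_addN.

Definition to_ext x : ext := insubd ext_zero x.

Lemma val_to_ext x : ab x = 0 -> val (to_ext x) = x.
Proof. by move=> /eqP abx; rewrite /to_ext val_insubd abx. Qed.

Lemma val_extD (z t : ext) : val (z + t) = (val z * val t)%g. Proof. by []. Qed.
Lemma val_extN (z : ext) : val (- z) = (val z)^-1%g. Proof. by []. Qed.

Definition lcomm x y : ext := to_ext [~ x, y]%g.
Lemma val_lcomm x y : val (lcomm x y) = [~ x, y]%g.
Proof. by rewrite val_to_ext // ab_comm. Qed.

Definition tau : A2 -> ext := lift (fun p => lcomm (b p.1) (b p.2)).
Lemma tauD : is_add tau. Proof. exact: lift_is_add. Qed.

Definition wedge_ext a c : ext := tau (tensor a c).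

Lemma wedge_extDl c : is_add (wedge_ext^~ c).
Proof. by move=> a a'; rewrite /wedge_ext tensorDl tauD. Qed.
Lemma wedge_extDr a : is_add (wedge_ext a).
Proof. by move=> c c'; rewrite /wedge_ext tensorDr tauD. Qed.

(** Commutators are bilinear in class two, so it suffices to compare on the basis. *)
Lemma lcomm_wedge x y : lcomm x y = wedge_ext (ab x) (ab y).
Proof.
have Ml u v w : lcomm (u * v)%g w = lcomm u w + lcomm v w.
  by apply: val_inj; rewrite val_extD !val_lcomm class2_commMl.
have Mr u v w : lcomm w (u * v)%g = lcomm w u + lcomm w v.
  by apply: val_inj; rewrite val_extD !val_lcomm class2_commMr.
move: y; apply: eq_on_basis => // [u v|j]; first by rewrite abM wedge_extDr.
rewrite ab_b; move: x; apply: eq_on_basis => // [u v|i].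
  by rewrite abM wedge_extDl.
by rewrite ab_b /wedge_ext tensor_basis /tau lift_basis.
Qed.

Lemma ext_ind (P : ext -> Prop) :
  P 0 -> (forall z t, P z -> P t -> P (z + t)) -> (forall z, P z -> P (- z)) ->
  (forall a c, P (wedge_ext a c)) -> forall z, P z.
Proof.
move=> P0 PD PN PW z; have := derived_of_ab (ext_ab z).
move=> /(derived_min (K := [set x | exists2 t, P t & val t = x]%classic))[||t].
- split=> /=; first by exists 0.
    by move=> _ _ [t Pt <-] [r Pr <-]; exists (t + r); [exact: PD|].
  by move=> _ [t Pt <-]; exists (- t); [exact: PN|].
- by move=> x y; exists (lcomm x y); [rewrite lcomm_wedge | rewrite val_lcomm].
by move=> Pt /val_inj <-.
Qed.

(** The antisymmetric matrix of an element of the derived subgroup. *)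
Definition mx (z : ext) : A2 := (kappa (val z)).2.

Lemma mxD : is_add mx.
Proof.
move=> z t; rewrite /mx val_extD kappaM heis_mulE /=.
by rewrite -!/(ab _) !ext_ab tensor0l addr0.
Qed.

Lemma mx_wedge a c : mx (wedge_ext a c) = tensor a c - tensor c a.
Proof.
have [x <-] := ab_onto a; have [y <-] := ab_onto c.
by rewrite -lcomm_wedge /mx val_lcomm (morph_groupR kappaM) heis_comm.
Qed.

(** A choice of one ordering of each unordered pair: it replaces a linear order
    of the basis in the normal form of a product of basic commutators. *)
Definition oriented i j := xget x0 [set k | k = i \/ k = j]%classic == i.

Lemma oriented_sym i j : i != j -> oriented j i = ~~ oriented i j.
Proof.
move=> ij; rewrite /oriented.
have -> : [set k | k = j \/ k = i]%classic = [set k | k = i \/ k = j]%classic.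
  by apply/seteqP; split=> k /= [->|->]; [right|left|right|left].
have P0 : exists k, [set k | k = i \/ k = j]%classic k by exists i; left.
have /= [->|->] := xgetPex x0 P0; first by rewrite eqxx (negPf ij).
by rewrite eqxx eq_sym (negPf ij).
Qed.

Definition upper : A2 -> A2 :=
  lift (fun p => if (p.1 != p.2) && oriented p.1 p.2 then basis A2 p else 0).

(** The elements [tau s] exhaust the derived subgroup, and the matrix of [tau s]
    is [s] minus its transpose. Its oriented half differs from [s] by a
    combination of matrix units along the diagonal and of symmetric pairs, which
    [tau] kills because commutators are alternating. *)
Lemma tau_upper_mx z : tau (upper (mx z)) = z.
Proof.
have [s <-] : exists s, tau s = z.
  elim/ext_ind: z => [|z t [s <-] [r <-]|z [s <-]|a c].
  - by exists 0; rewrite (add_map0 tauD).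
  - by exists (s + r); rewrite tauD.
  - by exists (- s); rewrite (add_mapN tauD).
  - by exists (tensor a c).
have upperD : is_add upper by exact: lift_is_add.
move: s; apply: eq_add_map; last case=> i j.
- exact: (is_add_comp tauD (is_add_comp upperD (is_add_comp mxD tauD))).
- exact: tauD.
rewrite -!(tensor_basis A) -/(wedge_ext _ _) mx_wedge !(tensor_basis A).
rewrite /wedge_ext tensor_basis (add_mapB upperD) (add_mapB tauD).
rewrite /upper !lift_basis /=.
have tauE k l : tau (basis A2 (k, l)) = lcomm (b k) (b l) by rewrite /tau lift_basis.
have lC k l : lcomm (b k) (b l) = - lcomm (b l) (b k).
  by apply: val_inj; rewrite val_extN !val_lcomm invgR.
have [->|ij] := eqVneq i j.
  rewrite /= (add_map0 tauD) subr0 tauE; apply: val_inj.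
  by rewrite val_lcomm commgg.
rewrite /= oriented_sym 1?eq_sym //.
case: oriented; rewrite /= !(add_map0 tauD) ?subr0 ?sub0r //.
by rewrite !tauE -lC.
Qed.

Definition iota_mx (eps : A -> int) : A2 -> A :=
  lift (fun p => e p.2 *~ eps (e p.1)).

Lemma iota_mxD eps : is_add (iota_mx eps). Proof. exact: lift_is_add. Qed.

Lemma iota_mx_tensor eps a c : is_add eps -> iota_mx eps (tensor a c) = c *~ eps a.
Proof.
move=> epsD; have ID := @iota_mxD eps.
move: a c; apply: eq_biadditive.
- by move=> c a a'; rewrite tensorDl ID.
- by move=> a c c'; rewrite tensorDr ID.
- by move=> c a a'; rewrite epsD mulrzDr.
- by move=> a c c'; rewrite mulrzDl.
- by move=> i j; rewrite tensor_basis /iota_mx lift_basis.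
Qed.

Lemma ext_div (m : int) (z : ext) :
  (forall i j, (m %| fa_coef j (iota_mx (fa_coef i) (mx z)))%Z) ->
  exists t, z = t *~ m.
Proof.
move=> H.
have cE i j s : fa_coef j (iota_mx (fa_coef i) s) = fa_coef (i, j) s.
  move: s; apply: eq_add_map; first exact: (is_add_comp (fa_coef_is_add j) (lift_is_add _)).
    exact: fa_coef_is_add.
  case=> p q; rewrite /iota_mx lift_basis fa_coefMz !fa_coef_basis /= xpair_eqE.
  by case: (p == i); case: (q == j).
have [s sP] := finite_support (mx z).
have [p ps|t tE] := @fa_realize _ A2 (fun p => (fa_coef p (mx z) %/ m)%Z) s.
  by rewrite sP // div0z.
exists (tau (upper t)); rewrite -[LHS]tau_upper_mx.
have upperD : is_add upper by exact: lift_is_add.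
rewrite -(add_mapMz tauD) -(add_mapMz upperD); congr (tau (upper _)).
apply: fa_coef_ext => -[i j]; rewrite fa_coefMz tE mulrC divzK //.
by rewrite -cE.
Qed.

Definition ext_square : exteriorSquare A.
Proof.
apply: (@ExteriorSquare _ A ext wedge_ext (fun eps z => iota_mx eps (mx z))).
- exact: wedge_extDl.
- exact: wedge_extDr.
- move=> a; have [x <-] := ab_onto a; rewrite -lcomm_wedge.
  by apply: val_inj; rewrite val_lcomm commgg.
- by move=> eps z t; rewrite mxD iota_mxD.
- move=> eps epsD a c; rewrite mx_wedge (add_mapB (@iota_mxD eps)).
  by rewrite !iota_mx_tensor.
- exact: ext_ind.
- exact: ext_div.
Defined.
End Commutators.

(** * Outer automorphisms *)
Section OuterModel.
Variables (X : choiceType) (A : freeAbelian X) (A2 : freeAbelian (X * X)%type).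
Variables (x0 : X) (N : groupType) (b : X -> N).
Hypothesis RF : relativelyFree2 b.
Local Notation e := (basis A).
Local Notation ab := (ab A A2 RF).
Local Notation ext := (ext A A2 RF).
Local Notation L := (ext_square A A2 x0 RF).
Local Notation wedge := (@wedge_ext X A A2 N b RF).
Local Notation to_ext := (@to_ext X A A2 N b RF).
Implicit Types (x y : N) (i j : X) (a c : A) (z t : ext).

Let N2 := rf_class2 RF.

Lemma ab_derived x : derived x -> ab x = 0.
Proof.
apply: (derived_min (K := [set x | ab x = 0]%classic)) => [|u v] /=; last exact: ab_comm.
split=> [|u v|u] /=; first exact: ab1; first by rewrite abM => -> ->; rewrite addr0.
by rewrite abV => ->; rewrite oppr0.
Qed.

Lemma section_subproof : exists s : A -> N, forall a, ab (s a) = a.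
Proof. by have [s sP] := choice (@ab_onto X A A2 N b RF); exists s. Qed.
Definition sec := projT1 (cid section_subproof).
Lemma secK a : ab (sec a) = a.
Proof. by rewrite /sec; case: cid. Qed.

Section Endomorphism.
Variable phi : N -> N.
Hypothesis phiM : {morph phi : x y / (x * y)%g}.

Lemma morph_derived x : derived x -> derived (phi x).
Proof.
have [d1 dM dV] := derived_subgroup N.
apply: (derived_min (K := [set x | derived (phi x)]%classic)).
  split=> /=; first by rewrite (morph_group1 phiM).
    by move=> u v hu hv; rewrite phiM; exact: dM.
  by move=> u hu; rewrite (morph_groupV phiM); exact: dV.
by move=> u v /=; rewrite (morph_groupR phiM); exact: derived_comm.
Qed.

Lemma ab_morph0 x : ab x = 0 -> ab (phi x) = 0.
Proof. by move=> /derived_of_ab/morph_derived/ab_derived. Qed.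

Lemma ab_morph x y : ab x = ab y -> ab (phi x) = ab (phi y).
Proof.
move=> xy; have : ab (phi (x^-1 * y)%g) = 0.
  by apply: ab_morph0; rewrite abM abV xy addNr.
by rewrite phiM (morph_groupV phiM) abM abV => /eqP; rewrite addrC subr_eq0 => /eqP.
Qed.
End Endomorphism.

Definition ab_map (phi : N -> N) a : A := ab (phi (sec a)).
Definition der_map (phi : N -> N) (z : ext) : ext := to_ext (phi (val z)).

Section InducedAction.
Variable phi : N -> N.
Hypothesis phiM : {morph phi : x y / (x * y)%g}.

Lemma ab_map_ab x : ab_map phi (ab x) = ab (phi x).
Proof. by apply: ab_morph; rewrite ?secK. Qed.

Lemma ab_map_is_add : is_add (ab_map phi).
Proof.
by move=> a c; rewrite -(secK a) -(secK c) -abM !ab_map_ab phiM abM.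
Qed.

Lemma val_der_map z : val (der_map phi z) = phi (val z).
Proof. by rewrite /der_map val_to_ext //; apply: ab_morph0 => //; exact: ext_ab. Qed.

Lemma der_map_is_add : is_add (der_map phi).
Proof. by move=> z t; apply: val_inj; rewrite val_extD !val_der_map val_extD phiM. Qed.

Lemma der_map_wedge a c : der_map phi (wedge a c) = wedge (ab_map phi a) (ab_map phi c).
Proof.
rewrite -(secK a) -(secK c) !ab_map_ab -!lcomm_wedge; apply: val_inj.
by rewrite val_der_map !val_lcomm (morph_groupR phiM).
Qed.

(** The action on the derived subgroup is determined by the action on the
    abelianization. *)
Lemma der_map_id : (forall x, ab (phi x) = ab x) -> forall x, ab x = 0 -> phi x = x.
Proof.
move=> abphi x abx; rewrite -(val_to_ext abx) -val_der_map; congr val.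
elim/ext_ind: (to_ext x) => [|z t hz ht|z hz|a c].
- exact: add_map0 der_map_is_add.
- by rewrite der_map_is_add hz ht.
- by rewrite (add_mapN der_map_is_add) hz.
- by rewrite der_map_wedge -{1}(secK a) -{1}(secK c) !ab_map_ab !abphi !secK.
Qed.

(** An endomorphism trivial on the abelianization is invertible: it only
    multiplies by central elements, which it fixes. *)
Lemma ab_id_bij : (forall x, ab (phi x) = ab x) -> bijective phi.
Proof.
move=> abphi; have fixK := der_map_id abphi.
pose d x := (x^-1 * phi x)%g.
have abd x : ab (d x) = 0 by rewrite abM abV abphi addNr.
have phid x : phi (x * (d x)^-1)%g = x.
  rewrite phiM (morph_groupV phiM) (fixK _ (abd x)) /d invgM invgK mulgA.
  by rewrite mulgV mul1g.
have phi_inj : injective phi.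
  move=> x y xy; apply: (mulgI x^-1%g); rewrite mulVg.
  have abxy : ab (x^-1 * y)%g = 0 by rewrite abM abV -abphi xy abphi addNr.
  by rewrite -(fixK _ abxy) phiM (morph_groupV phiM) xy mulVg.
exists (fun x => x * (d x)^-1)%g => x //.
by apply: phi_inj; rewrite phid.
Qed.
End InducedAction.

(** Lifts of [g] and of its inverse exist by freeness, and their composites are
    invertible by [ab_id_bij]. *)
Lemma lift_automorphism (g h : A -> A) : is_add g -> cancel g h -> cancel h g ->
  exists gam : aut N, forall x, ab (gam x) = g (ab x).
Proof.
move=> gD gK hK; have hD := is_add_can gD gK hK.
have ext_morph k : is_add k -> exists2 phi : N -> N,
    {morph phi : x y / (x * y)%g} & forall x, ab (phi x) = k (ab x).
  move=> kD; have [phi phiM phib] := rf_extend RF (fun i => sec (k (e i))) N2.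
  exists phi => //; apply: (eq_on_basis RF (f := ab \o phi) (g := k \o ab)).
  - by move=> x y /=; rewrite phiM abM.
  - by move=> x y /=; rewrite abM kD.
  - by move=> i /=; rewrite phib secK ab_b.
have [phi phiM phig] := ext_morph g gD; have [psi psiM psih] := ext_morph h hD.
have [k1 k1K _] : bijective (psi \o phi).
  apply: ab_id_bij => x /=; last by rewrite psih phig gK.
  by move=> y; rewrite /= phiM psiM.
have [k2 _ k2K] : bijective (phi \o psi).
  apply: ab_id_bij => x /=; last by rewrite phig psih hK.
  by move=> y; rewrite /= psiM phiM.
have phiB : bijective phi.
  exists (k1 \o psi) => x /=; first exact: k1K.
  by rewrite -[x in LHS]k2K /= -[X in psi X]/((phi \o psi) (k2 x)) /= [k1 _]k1K; exact: k2K.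
by exists (Automorphism phiM phiB).
Qed.

Section IA.
Variable phi : A -> ext.
Hypothesis phiD : is_add phi.

Definition ia_fun x := (x * val (phi (ab x)))%g.

Lemma ab_ia_fun x : ab (ia_fun x) = ab x.
Proof. by rewrite /ia_fun abM ext_ab addr0. Qed.

Lemma ia_funM : {morph ia_fun : x y / (x * y)%g}.
Proof.
move=> x y; rewrite /ia_fun abM phiD val_extD.
have C := ab_central y (ext_ab (phi (ab x))).
by rewrite -(mulgA x) (mulgA y) -C -!mulgA.
Qed.

Lemma ia_fun_bij : bijective ia_fun.
Proof. by apply: ab_id_bij; [exact: ia_funM | exact: ab_ia_fun]. Qed.
End IA.

(** [linearModel] takes a total function of [phi]; maps that are not additive are
    sent to the identity. *)
Definition ia_aut (phi : A -> ext) : aut N :=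
  if pselect (is_add phi) is left phiD
  then Automorphism (ia_funM phiD) (ia_fun_bij phiD) else aut_one N.

Lemma ia_autE phi : is_add phi -> forall x, ia_aut phi x = (x * val (phi (ab x)))%g.
Proof. by move=> phiD x; rewrite /ia_aut; case: pselect. Qed.

Local Notation G := (out N).
Local Notation pi := (\pi_(quotient_group (inn N))).

Lemma conj_central x y : ab x = 0 -> (x ^ y)%g = x.
Proof. by move=> abx; apply/conjg_fixP/commgP; exact: (ab_central y abx). Qed.

(** Conjugations act trivially on [A], and on the derived subgroup, which is central. *)
Lemma pi_eq_act (gam del : aut N) : pi gam = pi del ->
  (forall a, ab_map gam a = ab_map del a) /\ (forall z, der_map gam z = der_map del z).
Proof.
move/quot_pi_eq => -[g gE].
have delE x : del x = gam (x ^ g)%g.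
  by rewrite -gE /= aut_inv_funK.
split=> [a|z].
  rewrite /ab_map delE; apply: (ab_morph (aut_morph gam)).
  by rewrite /conjg !abM abV addrCA addNr addr0.
apply: val_inj; rewrite !val_der_map; try exact: aut_morph.
by rewrite delE conj_central //; exact: ext_ab.
Qed.

Definition out_act (u : G) : A -> A := ab_map (repr u).
Definition out_eact (u : G) : ext -> ext := der_map (repr u).
Definition out_ia (phi : A -> ext) : G := pi (ia_aut phi).

Lemma out_act_pi (gam : aut N) a : out_act (pi gam) a = ab_map gam a.
Proof. by have [h _] := @pi_eq_act (repr (pi gam)) gam (reprK _); exact: h. Qed.
Lemma out_eact_pi (gam : aut N) z : out_eact (pi gam) z = der_map gam z.
Proof. by have [_ h] := @pi_eq_act (repr (pi gam)) gam (reprK _); exact: h. Qed.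

Lemma pi_mul (gam del : aut N) : (pi gam * pi del)%g = pi (gam * del)%g :> G.
Proof. by rewrite quot_piM. Qed.
Lemma pi_inv (gam : aut N) : (pi gam)^-1%g = pi gam^-1%g :> G.
Proof. by rewrite (morph_groupV (@quot_piM _ (inn N))). Qed.

(** The map [x |-> x^-1 gam(x)] takes values in the derived subgroup, which is
    central and fixed by [gam]; so it is a homomorphism that factors through
    [ab]. *)
Lemma out_act_trivial u : (forall a, out_act u a = a) ->
  exists2 phi, is_add phi & u = out_ia phi.
Proof.
elim/quot_ind: u => gam gid.
have {}gid x : ab (gam x) = ab x.
  by rewrite -(ab_map_ab (aut_morph gam)) -out_act_pi gid.
have fixK := der_map_id (aut_morph gam) gid.
pose d x := (x^-1 * gam x)%g.
have abd x : ab (d x) = 0 by rewrite abM abV gid addNr.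
have dM x y : d (x * y)%g = (d x * d y)%g.
  have C := ab_central y^-1%g (abd x).
  transitivity (y^-1 * d x * gam y)%g; first by rewrite /d aut_morph invgM !mulgA.
  by rewrite -C /d !mulgA.
pose phi a := to_ext (d (sec a)).
have phi_ab x : val (phi (ab x)) = d x.
  rewrite /phi val_to_ext //.
  have abx : ab (x^-1 * sec (ab x))%g = 0 by rewrite abM abV secK addNr.
  have -> : sec (ab x) = (x * (x^-1 * sec (ab x)))%g by rewrite mulVKg.
  by rewrite dM {2}/d (fixK _ abx) mulVg mulg1.
have phiD : is_add phi.
  move=> a c; apply: val_inj; rewrite val_extD -(secK a) -(secK c) -abM !phi_ab.
  exact: dM.
exists phi => //; congr pi; apply: aut_fun_inj => x.
by rewrite ia_autE // phi_ab mulVKg.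
Qed.

Definition out_model : linearModel L G.
Proof.
apply: (@LinearModel _ A L G out_act out_eact out_ia).
- by move=> u; apply: ab_map_is_add; exact: aut_morph.
- move=> a; rewrite -[1%g]/(pi 1%g) out_act_pi; exact: secK.
- elim/quot_ind=> gam; elim/quot_ind=> del a.
  rewrite pi_mul !out_act_pi -{2}(secK a) (ab_map_ab (aut_morph del)).
  by rewrite (ab_map_ab (aut_morph gam)).
- move=> g h gD gK hK; have [gam gamE] := lift_automorphism gD gK hK.
  by exists (pi gam) => a; rewrite out_act_pi /ab_map gamE secK.
- by move=> u; apply: der_map_is_add; exact: aut_morph.
- by move=> u a c; apply: der_map_wedge; exact: aut_morph.
- move=> phi phiD a; rewrite out_act_pi /ab_map ia_autE //.
  by rewrite abM ext_ab addr0 secK.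
- exact: out_act_trivial.
- move=> phi psi phiD psiD; rewrite /out_ia pi_mul; congr pi.
  apply: aut_fun_inj => x; rewrite ia_autE; last exact: is_addD.
  rewrite /= !ia_autE // -mulgA; congr (_ * _)%g.
  rewrite abM ext_ab addr0 -!val_extD; congr val; exact: addrC.
- move=> phi phiD; rewrite quot_pi_eq1; split=> [[g gE]|[a aE]].
    exists (ab g) => c; rewrite -(secK c) -[RHS]/(wedge _ _) -lcomm_wedge; apply: val_inj.
    rewrite val_lcomm; apply: (mulgI (sec c)).
    by rewrite -ia_autE // gE commgEl mulVKg.
  exists (sec a) => x; rewrite ia_autE //.
  have -> : phi (ab x) = lcomm A A2 RF x (sec a) by rewrite aE lcomm_wedge secK.
  by rewrite val_lcomm commgEl mulVKg.
move=> phi; elim/quot_ind=> gam phiD.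
rewrite /out_ia /conjg pi_inv (pi_mul (ia_aut phi) gam) (pi_mul gam^-1%g); congr pi; apply: aut_fun_inj => x.
have D : is_add (fun c => out_eact (pi gam^-1%g) (phi (out_act (pi gam) c))).
  move=> c d; rewrite /out_act /out_eact (ab_map_is_add (aut_morph _)) phiD.
  exact: (der_map_is_add (aut_morph _)).
rewrite [RHS]ia_autE // out_eact_pi out_act_pi (ab_map_ab (aut_morph gam)).
rewrite (val_der_map (aut_morph _)) -[LHS]/(aut_inv_fun gam (ia_aut phi (gam x))).
by rewrite ia_autE // aut_inv_morph aut_funK.
Defined.
End OuterModel.

Theorem theorem4p1 (X : Type) (N : groupType) :
  infinite_set [set: X]%classic -> free_nilpotent2 X N -> complete_group (out N).
Proof.
move=> Xinf /relatively_free_of_free[b RF].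
have [nx nx_inj] : exists nx : nat -> X, injective nx.
  have x0 : X by have [x _] := cid (infinite_setN0 Xinf).
  have /infiniteP/card_leP[f] := Xinf.
  exists (fun n => val (f (exist _ n (mem_setT n)))) => m n /val_inj /(inj _ _)/(congr1 val).
  by apply; exact: mem_setT.
exact: (model_complete (out_model (malg_free {classic X}) (malg_free _) (nx 0) RF) nx_inj).
Qed.
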